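(* Let $k$ be an integer with $2k+1\ge 5$ and let $A=\begin{bmatrix}0&-1\\1&2k+1\end{bmatrix}\in SL(2,\mathbb{Z})$. Then the group $G=\mathbb{Z}^2\rtimes_A\mathbb{Z}$ has rational growth with respect to its standard generating set $S=\{a,b,t\}$; that is, the growth series $\sum_{n\ge 0}V(n;S)\,z^n$ is (the power series expansion of) a rational function of $z$.
   Context: $a=\begin{bmatrix}1\\0\end{bmatrix}$ and $b=\begin{bmatrix}0\\1\end{bmatrix}$ are the standard basis vectors of $\mathbb{Z}^2$, and $t$ is the generator of the infinite cyclic factor, acting by $t\,x\,t^{-1}=A\cdot x$ for $x\in\mathbb{Z}^2$. Thus $G=\langle a,b,t\mid [a,b]=1,\ tat^{-1}=b,\ tbt^{-1}=a^{-1}b^{2k+1}\rangle$. The word length of an element of $G$ with respect to $S$ is the least length of a word in $a^{\pm1},b^{\pm1},t^{\pm1}$ representing it, and $V(n;S)$ denotes the number of elements of $G$ of word length at most $n$ (the size of the ball of radius $n$ in the Cayley graph). *)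

(* Defs.v *)
From HB Require Import structures.
From mathcomp Require Import all_boot all_order all_algebra.
From mathcomp Require Import finmap.
From mathcomp Require Import mathcomp_extra boolp classical_sets cardinality.

Set Implicit Arguments.
Unset Strict Implicit.
Unset Printing Implicit Defensive.

Import Order.TTheory GRing.Theory Num.Theory.

Local Open Scope classical_set_scope.
Local Open Scope ring_scope.

Definition SL2Z : Type := {A : 'M[int]_2 | \det A == 1}.

Lemma SL2Z_unit (A : SL2Z) : val A \is a GRing.unit.
Proof.
have : val A \in unitmx by rewrite unitmxE (eqP (valP A)) unitr1.
by [].
Qed.

(* [SemiZ x m] stands for x t^m, so that the product below encodes
   t x t^-1 = A x; see [semiZ_conj]. *)
Record semiZ (A : SL2Z) : Type := SemiZ { vecpart : 'cV[int]_2; tpart : int }.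

Section SemidirectProduct.
Variable A : SL2Z.
Implicit Types g h : semiZ A.

Definition semiZ_pair g := (vecpart g, tpart g).
Definition pair_semiZ (p : 'cV[int]_2 * int) : semiZ A := SemiZ A p.1 p.2.

Lemma semiZ_pairK : cancel semiZ_pair pair_semiZ.
Proof. by case. Qed.

HB.instance Definition _ := Choice.copy (semiZ A) (can_type semiZ_pairK).

Definition semiZ_mul g h : semiZ A :=
  SemiZ A (vecpart g + val A ^ tpart g *m vecpart h) (tpart g + tpart h).

Definition semiZ_one : semiZ A := SemiZ A 0 0.

Definition semiZ_inv g : semiZ A :=
  SemiZ A (- (val A ^ (- tpart g) *m vecpart g)) (- tpart g).

Lemma semiZ_mulA : associative semiZ_mul.
Proof.
move=> [x m] [y n] [z p]; rewrite /semiZ_mul /= mulmxDr !addrA.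
by rewrite mulmxA -[_ *m _ ^ n]/(_ * _) -exprzDr ?SL2Z_unit.
Qed.

Lemma semiZ_mul1 : left_id semiZ_one semiZ_mul.
Proof. by case=> x m; rewrite /semiZ_mul /= expr0z mul1mx !add0r. Qed.

Lemma semiZ_1mul : right_id semiZ_one semiZ_mul.
Proof. by case=> x m; rewrite /semiZ_mul /= mulmx0 !addr0. Qed.

Lemma semiZ_mulV : left_inverse semiZ_one semiZ_inv semiZ_mul.
Proof. by case=> x m; rewrite /semiZ_mul /= addNr addNr. Qed.

Lemma semiZ_Vmul : right_inverse semiZ_one semiZ_inv semiZ_mul.
Proof.
case=> x m; rewrite /semiZ_mul /= mulmxN mulmxA -[_ *m _ ^ (- m)]/(_ * _).
by rewrite -exprzDr ?SL2Z_unit // subrr expr0z mul1mx !subrr.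
Qed.

HB.instance Definition _ := isGroup.Build (semiZ A)
  semiZ_mulA semiZ_mul1 semiZ_1mul semiZ_mulV semiZ_Vmul.

Definition vec_elt (x : 'cV[int]_2) : semiZ A := SemiZ A x 0.

Definition gen_a : semiZ A := vec_elt (delta_mx 0 0).
Definition gen_b : semiZ A := vec_elt (delta_mx 1 0).
Definition gen_t : semiZ A := SemiZ A 0 1.

Definition std_gens : set (semiZ A) := [set gen_a; gen_b; gen_t].

Lemma semiZ_conj (x : 'cV[int]_2) :
  (gen_t * vec_elt x * gen_t^-1)%g = vec_elt (val A *m x).
Proof.
congr SemiZ => /=.
by rewrite expr1z mulmx0 oppr0 mulmx0 addr0 add0r.
Qed.

End SemidirectProduct.

Arguments std_gens A : clear implicits.

Section Growth.
Variable G : groupType.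
Implicit Types (S : set G) (g : G) (w : seq G) (n : nat).

Definition is_word S w := forall x, x \in w -> S x \/ S (x^-1)%g.

Definition represents S w g := is_word S w /\ (\prod_(x <- w) x)%g = g.

Definition has_word_length S g n :=
  (exists2 w, represents S w g & size w = n) /\
  (forall w, represents S w g -> (n <= size w)%N).

Definition word_ball S n : set G :=
  [set g | exists2 m, has_word_length S g m & (m <= n)%N].

(* [fset_set] is only meaningful on finite sets; see [finite_word_ball]. *)
Definition ball_size S n : nat := #|` fset_set (word_ball S n)|%fset.

Lemma finite_word_ball S n : finite_set S -> finite_set (word_ball S n).
Proof.
move=> finS; pose L : set G := S `|` (fun x => x^-1)%g @` S.
have finL : finite_set L by rewrite finite_setU; split; last exact: finite_image.
pose B n : set G := [set g | exists2 w,
  represents S w g & (size w <= n)%N].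
apply: (@sub_finite_set _ _ (B n)).
  by move=> g [m [[w wg <-] _] le_mn]; exists w.
elim: n => [|n IHn].
  apply: (@sub_finite_set _ _ [set 1%g]) (finite_set1 _) => g [w [_ <-]].
  by rewrite leqn0 => /nilP ->; rewrite big_nil.
have fin2 := finite_image2 (fun x y => x * y)%g finL IHn.
apply: (@sub_finite_set _ _ (1%g |` [set (x * y)%g | x in L & y in B n])).
  move=> g [[|x w] [Sw <-] lewn]; first by left; rewrite big_nil.
  right; rewrite big_cons; exists x.
    have [|Sx|Sx] := Sw x; first by rewrite mem_head.
      by left.
    by right; exists (x^-1)%g; rewrite ?invgK.
  exists (\prod_(y <- w) y)%g => //; exists w => //; split=> // y yw.
  by apply: Sw; rewrite inE yw orbT.
by rewrite finite_setU; split.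
Qed.

End Growth.

(* The formal series sum_n f n z^n equals P / Q in F[[z]]: Q is invertible
   there exactly when its constant coefficient is nonzero, and the Cauchy
   product of Q with the series is P. *)
Definition rational_series (F : fieldType) (f : nat -> F) : Prop :=
  exists P Q : {poly F}, Q`_0 != 0 /\
    forall n : nat, \sum_(i < n.+1) Q`_i * f (n - i)%N = P`_n.

Definition rational_growth (G : groupType) (S : set G) : Prop :=
  rational_series (fun n => (ball_size S n)%:R : rat).

Definition mx2 (p q r s : int) : 'M[int]_2 :=
  \matrix_(i, j) (if i == 0 then (if j == 0 then p else q)
                  else (if j == 0 then r else s)).

Definition Amx (k : int) : 'M[int]_2 := mx2 0 (-1) 1 (2 * k + 1).

Lemma det_Amx (k : int) : \det (Amx k) == 1.
Proof.
rewrite (expand_det_row _ 0) !big_ord_recl big_ord0 /cofactor !det_mx11 !mxE /=.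
by rewrite mul0r add0r addr0 expr1 mulr1 mulN1r opprK.
Qed.

Definition ASL (k : int) : SL2Z := Sub (Amx k) (det_Amx k).

(* Main.v *)
From HB Require Import structures.
From mathcomp Require Import all_boot all_order all_algebra finmap.
From mathcomp Require Import zify ring.
From mathcomp Require Import boolp classical_sets cardinality.
Require Import Defs.

Set Implicit Arguments.
Unset Strict Implicit.
Unset Printing Implicit Defensive.

Import Order.TTheory GRing.Theory Num.Theory.
Local Open Scope classical_set_scope.
Local Open Scope ring_scope.

(** Put T = 2k + 1 and identify Z^2 with Z[X]/(X^2 - T X + 1) so that a = 1,
    b = X and t acts as multiplication by X.  A word in a, b, t drives a cursor
    along Z: t moves it, and at position i the letters a and b add X^i and
    X^(i+1).  An element (x, m) is therefore described by a Laurent polynomial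
    with value x, together with an interval of visited positions, and its
    length is the least l1-norm of the digits plus the length of a walk from 0
    to m through the interval ([word_lengthP]).  Cutting the line at the final
    position of the cursor, x = y + swap z is the sum of what lies on the left
    and of the mirror image of what lies on the right, and the cost is the sum
    of the costs of the two halves ([min_config_total]).

    The cost of a half ([halfcost]) is computed one digit at a time, like a
    shortest path in an infinite graph.  The point is that it can be followed
    with a finite memory.  Since X^(i+1) - T X^i + X^(i-1) = 0, a digit may be
    changed by T at the price of changing its two neighbours by 1; this keeps
    the digits of optimal representations bounded as soon as T is at least 5
    ([digit_bound]), even where the change makes the interval grow.  Reading
    a digit multiplies the value of what remains by X, which expands
    differences; so two representations with bounded digits whose values differ
    by too much keep drifting apart, whereas both must end at 0
    ([offset_growth]).  So an optimal half y only competes with the 25 halves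
    y + v with v in a fixed box.  The cost varies by a bounded amount on such
    a box, hence the profile of y, made of the differences between the costs of
    y + v and of y, takes finitely many values.  The profile of a half
    determines which digits extend it optimally and the profiles obtained
    ([similar_children]), and the profiles of two halves determine whether
    gluing them is optimal ([best_similar]).

    Optimal halves thus form a tree with finitely many types of nodes; counting
    its nodes by type and cost gives a finite linear system over the power
    series, which is solved by Cramer's rule ([rational_nodes]).  With ties
    broken in a way that only depends on the offsets v, every group element
    arises from exactly one pair of halves, so spheres are counted by a finite
    sum of Cauchy products of these series ([card_gluings], [card_sphere]), and
    balls by its partial sums. *)

(** * Rational power series *)

Section Rational.
Variable K : fieldType.
Implicit Types (f g : nat -> K) (A B P Q : {poly K}) (n N : nat).

(** The multiplication of power series is that of their truncations, taken
    modulo the power of the indeterminate that [eqmod] neglects. *)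
Definition trunc N f : {poly K} := \poly_(i < N.+1) f i.

Definition eqmod N A B := forall n, (n <= N)%N -> A`_n = B`_n.

Lemma eqmodM N A A' B B' :
  eqmod N A A' -> eqmod N B B' -> eqmod N (A * B) (A' * B').
Proof.
move=> AA' BB' n le_nN; rewrite !coefM; apply: eq_bigr => i _.
by rewrite AA' ?BB' // (leq_trans _ le_nN) ?leq_subr // -ltnS.
Qed.

Lemma eqmodMl N A B B' : eqmod N B B' -> eqmod N (A * B) (A * B').
Proof. exact: eqmodM. Qed.

Lemma eqmodD N A A' B B' :
  eqmod N A A' -> eqmod N B B' -> eqmod N (A + B) (A' + B').
Proof. by move=> AA' BB' n le_nN; rewrite !coefD AA' ?BB'. Qed.

Lemma eqmod_trans N A B C : eqmod N A B -> eqmod N B C -> eqmod N A C.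
Proof. by move=> AB BC n le_nN; rewrite AB ?BC. Qed.

Lemma rational_seriesP f :
  rational_series f <->
  exists P Q, Q`_0 != 0 /\ forall N, eqmod N (Q * trunc N f) P.
Proof.
have coefE Q n N : (n <= N)%N ->
    (Q * trunc N f)`_n = \sum_(i < n.+1) Q`_i * f (n - i)%N.
  move=> le_nN; rewrite coefM; apply: eq_bigr => i _; rewrite coef_poly ifT //.
  by rewrite ltnS (leq_trans _ le_nN) ?leq_subr.
split=> -[P [Q [Q0 fE]]]; exists P, Q; split=> //.
  by move=> N n le_nN; rewrite coefE.
by move=> n; rewrite -(coefE Q n n) ?fE.
Qed.

Lemma eq_rational f g : f =1 g -> rational_series f -> rational_series g.
Proof.
move=> fg [P [Q [Q0 fE]]]; exists P, Q; split=> // n.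
by rewrite -fE; apply: eq_bigr => i _; rewrite fg.
Qed.

Lemma rational0 : rational_series (fun _ => 0 : K).
Proof.
exists 0, 1; rewrite coef1 oner_eq0; split=> // n.
by rewrite coef0 big1 // => i _; rewrite mulr0.
Qed.

Lemma rational1 : rational_series (fun _ => 1 : K).
Proof.
exists 1, (1 - 'X); rewrite coefB coef1 coefX subr0 oner_eq0; split=> // n.
rewrite big_ord_recl coefB coef1 coefX subr0 mulr1 coef1.
case: n => [|n]; first by rewrite big_ord0 addr0.
rewrite big_ord_recl big1 => [|i _]; last first.
  by rewrite coefB coef1 coefX /= subrr mul0r.
by rewrite coefB coef1 coefX /= sub0r mulr1 addr0 subrr.
Qed.

Lemma rationalD f g : rational_series f -> rational_series g ->
  rational_series (fun n => f n + g n).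
Proof.
move=> /rational_seriesP[P [Q [Q0 fE]]] /rational_seriesP[P' [Q' [Q'0 gE]]].
apply/rational_seriesP; exists (Q' * P + Q * P'), (Q * Q').
rewrite coefM big_ord1 mulf_neq0 //; split=> // N.
have -> : trunc N (fun n => f n + g n) = trunc N f + trunc N g.
  by apply/polyP => i; rewrite coefD !coef_poly; case: ifP; rewrite ?addr0.
by rewrite mulrDr {1}(mulrC Q) -!mulrA; apply: eqmodD; apply: eqmodMl.
Qed.

Lemma rationalM f g : rational_series f -> rational_series g ->
  rational_series (fun n => \sum_(i < n.+1) f i * g (n - i)%N).
Proof.
move=> /rational_seriesP[P [Q [Q0 fE]]] /rational_seriesP[P' [Q' [Q'0 gE]]].
apply/rational_seriesP; exists (P * P'), (Q * Q').
rewrite coefM big_ord1 mulf_neq0 //; split=> // N.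
apply: (@eqmod_trans _ _ ((Q * trunc N f) * (Q' * trunc N g))); last exact: eqmodM.
rewrite mulrACA; apply: eqmodMl => n le_nN.
rewrite coef_poly ltnS le_nN coefM; apply: eq_bigr => i _.
rewrite !coef_poly !ltnS (leq_trans _ le_nN) ?(leq_trans _ le_nN) ?leq_subr //.
by rewrite -ltnS.
Qed.

Lemma rational_sum (I : Type) (r : seq I) (f : I -> nat -> K) :
  (forall i, rational_series (f i)) ->
  rational_series (fun n => \sum_(i <- r) f i n).
Proof.
move=> f_rat; elim: r => [|i r IHr].
  by apply: eq_rational rational0 => n; rewrite big_nil.
by apply: eq_rational (rationalD (f_rat i) IHr) => n; rewrite big_cons.
Qed.

Lemma rational_tail f : rational_series f -> rational_series (fun n => f n.+1).
Proof.
move=> /rational_seriesP[P [Q [Q0 fE]]]; apply/rational_seriesP.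
exists (drop_poly 1 (P - Q * (f 0%N)%:P)), Q; split=> // N n le_nN.
rewrite coef_drop_poly addn1 coefB -(fE N.+1) // -coefB -mulrBr.
have -> : trunc N.+1 f - (f 0%N)%:P = 'X * trunc N (fun n => f n.+1).
  apply/polyP => i; rewrite coefB coefXM coefC !coef_poly.
  by case: i => [|i] /=; rewrite ?subrr ?subr0 ?ltnS.
by rewrite mulrCA coefXM.
Qed.

(** Cramer's rule: the matrix 1 - M of the system is the identity at 0, so that
    its determinant is invertible as a power series. *)
Lemma rational_system r (M : 'M[{poly K}]_r) (P : 'I_r -> {poly K})
    (f : 'I_r -> nat -> K) :
  (forall i j, (M i j)`_0 = 0) ->
  (forall N i, eqmod N (trunc N (f i)) (P i + \sum_j M i j * trunc N (f j))) ->
  forall i, rational_series (f i).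
Proof.
move=> M0 fE i; apply/rational_seriesP; pose U := 1%:M - M.
exists (\sum_j (\adj U) i j * P j), (\det U); split.
  have -> : (\det U)`_0 = 1; last exact: oner_neq0.
  rewrite -horner_coef0 -[_.[0]]/(horner_eval 0 (\det U)) -det_map_mx.
  rewrite -[RHS](det1 K r); congr (\det _); apply/matrixP => a b.
  rewrite !mxE [LHS]horner_coef0 coefB M0 subr0.
  by case: eqP => _; rewrite ?coef1 ?coef0.
move=> N; pose v : 'cV[{poly K}]_r := \col_j trunc N (f j).
have -> : \det U * trunc N (f i) = \sum_j \adj U i j * (U *m v) j 0.
  have := congr1 (fun W : 'M_r => (W *m v) i 0) (mul_adj_mx U).
  by rewrite mul_scalar_mx -mulmxA mxE => ->; rewrite !mxE.
have Uv j : eqmod N ((U *m v) j 0) (P j).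
  rewrite mulmxBl mul1mx !mxE => n le_nN.
  have -> : \sum_k M j k * v k 0 = \sum_k M j k * trunc N (f k).
    by apply: eq_bigr => k _; rewrite mxE.
  by rewrite coefB fE // coefD addrK.
by move=> n le_nN; rewrite !coef_sum; apply: eq_bigr => j _; apply: eqmodMl (Uv j) _ _.
Qed.

End Rational.

(** * Counting finite sets *)

Section Card.

Definition card (T : choiceType) (A : set T) : nat := #|` fset_set A|%fset.

Lemma card_seq (T : choiceType) (s : seq T) (A : set T) :
  uniq s -> (forall x, x \in s <-> A x) -> card A = size s.
Proof.
move=> s_uniq sA; rewrite /card.
have -> : A = [set` [fset x in s]%fset].
  by apply/seteqP; split=> x /=; rewrite !inE => /sA.
by rewrite set_fsetK card_fseq undup_id.
Qed.

Lemma card_set0 (T : choiceType) : card (set0 : set T) = 0%N.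
Proof. by rewrite (@card_seq _ [::]). Qed.

Lemma card_set1 (T : choiceType) (x : T) : card [set x] = 1%N.
Proof.
by rewrite (@card_seq _ [:: x]) // => y; rewrite inE; split=> [/eqP|->].
Qed.

Lemma card_image (T U : choiceType) (f : T -> U) (A : set T) :
  finite_set A -> {in A &, injective f} -> card (f @` A) = card A.
Proof.
move=> finA f_inj; rewrite /card fset_set_image // card_in_imfset // => x y.
by rewrite !in_fset_set //; exact: f_inj.
Qed.

Lemma card_prod (T U : choiceType) (A : set T) (B : set U) :
  finite_set A -> finite_set B -> card (A `*` B) = (card A * card B)%N.
Proof.
move=> finA finB.
pose s := [seq (x, y) | x <- enum_fset (fset_set A), y <- enum_fset (fset_set B)].
rewrite (@card_seq _ s) ?size_allpairs //.
  by rewrite allpairs_uniq // => -[x y] [x' y'] _ _ [-> ->].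
move=> [x y]; split.
  move=> /allpairsP[[x' y'] /= []].
  by rewrite !in_fset_set // !inE => Ax By [-> ->].
by move=> [Ax By]; apply/allpairsP; exists (x, y); rewrite /= !in_fset_set // !inE.
Qed.

Lemma card_partition (T : choiceType) (I : finType) (A : set T) (R : I -> set T) :
  finite_set A -> (forall x, A x -> exists i, R i x) ->
  (forall x i i', A x -> R i x -> R i' x -> i = i') ->
  card A = (\sum_i card (A `&` R i))%N.
Proof.
move=> finA R_ex R_uniq; pose s : seq T := enum_fset (fset_set A).
have sA x : x \in s <-> A x by rewrite /s in_fset_set // inE.
have s_uniq : uniq s by exact: fset_uniq.
have cardR i : card (A `&` R i) = (\sum_(x <- s) (`[< R i x >] : nat))%N.
  rewrite (@card_seq _ [seq x <- s | `[< R i x >]]) ?filter_uniq //.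
    by rewrite size_filter -sum1_count big_mkcond; apply: eq_bigr => x _; case: asboolP.
  move=> x; rewrite mem_filter; split; first by case/andP=> /asboolP ? /sA.
  by move=> [/sA -> Rx]; rewrite andbT; apply/asboolP.
under eq_bigr do rewrite cardR.
rewrite exchange_big /= (_ : card A = size s) // -sum1_size big_seq [RHS]big_seq.
apply: eq_bigr => x /sA Ax; have [i Ri] := R_ex x Ax.
rewrite (bigD1 i) //= big1 ?addn0; first by case: asboolP.
by move=> i' /eqP i'i; case: asboolP => // /(R_uniq _ _ _ Ax Ri) /esym /i'i.
Qed.

End Card.

(** * Trees with finitely many node types *)

(** The nodes of a tree are counted by length.  Only finitely many labels
    exist, and the label of a node determines the labels of its children and
    the lengths of the edges leading to them; so the numbers of nodes with a
    given label and length obey a finite linear recursion. *)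
Section Tree.
Variables (T : choiceType) (V : set T) (len : T -> nat) (root : T).
Variables (r : nat) (lab : T -> 'I_r) (E : finType) (inc : E -> nat).
Variable (edge : T -> E -> T -> Prop).

Hypothesis inc_gt0 : forall e, (0 < inc e)%N.
Hypothesis edge_V :
  forall x e y, V x -> edge x e y -> V y /\ len y = (len x + inc e)%N.
Hypothesis edge_fun : forall x e y y', edge x e y -> edge x e y' -> y = y'.
Hypothesis edge_inj :
  forall x e x' e' y, V x -> V x' -> edge x e y -> edge x' e' y -> x = x' /\ e = e'.
Hypothesis V_ex : forall y, V y -> y = root \/ exists x e, V x /\ edge x e y.
Hypothesis V_root : V root.
Hypothesis len_root : len root = 0%N.
Hypothesis edge_lab : forall x x' e y, V x -> V x' -> lab x = lab x' ->
  edge x e y -> exists2 y', edge x' e y' & lab y' = lab y.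

Definition nodes (i : 'I_r) (n : nat) : set T :=
  [set x | [/\ V x, len x = n & lab x = i]].

Definition child e x : T := xget x (edge x e).

Lemma childE x e y : edge x e y -> child e x = y.
Proof.
by move=> xey; rewrite /child; case: xgetP => [z _ /edge_fun|/(_ y)]; [apply|].
Qed.

Lemma finite_ball n : finite_set [set x | V x /\ (len x <= n)%N].
Proof.
elim: n => [|n IHn].
  apply: sub_finite_set (finite_set1 root) => x [Vx].
  case: (V_ex Vx) => // -[y [e [Vy yex]]].
  have [_ ->] := edge_V Vy yex; have := inc_gt0 e.
  by case: (inc e) => // m _; rewrite addnS.
apply: (@sub_finite_set _ _ ([set root] `|`
    \bigcup_(e in [set: E]) (child e @` [set x | V x /\ (len x <= n)%N]))).
  move=> x [Vx len_x]; case: (V_ex Vx) => [->|]; first by left.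
  move=> [y [e [Vy yex]]]; right; exists e => //; exists y; last exact: childE.
  split=> //; have [_ xE] := edge_V Vy yex; have := inc_gt0 e.
  by move=> e_gt0; rewrite -ltnS (leq_trans _ len_x) // xE -addn1 leq_add2l.
rewrite finite_setU; split; first exact: finite_set1.
apply: bigcup_finite => [|e _]; first exact: finite_finset.
exact: finite_image.
Qed.

Lemma finite_nodes i n : finite_set (nodes i n).
Proof. by apply: sub_finite_set (finite_ball n) => x [Vx <- _]. Qed.

Definition keyed (k : 'I_r * E) : set T :=
  [set y | exists x, [/\ V x, lab x = k.1 & edge x k.2 y]].

Lemma not_keyed_root k : ~ keyed k root.
Proof.
move=> [x [Vx _ /(edge_V Vx)[_]]]; rewrite len_root => /esym/eqP.
by rewrite addn_eq0 => /andP[_]; rewrite eqn0Ngt inc_gt0.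
Qed.

(** By [edge_lab] one witness decides for all nodes with that label. *)
Definition leads (k : 'I_r * E) (i : 'I_r) : bool :=
  `[< exists x y, [/\ V x, lab x = k.1, edge x k.2 y & lab y = i] >].

Lemma card_keyed i n k :
  card (nodes i n `&` keyed k) =
  (if leads k i && (inc k.2 <= n) then card (nodes k.1 (n - inc k.2)) else 0)%N.
Proof.
case: k => i0 e /=; case: ifP => [/andP[/asboolP[x0 [y0 [Vx0 x0i x0y0 y0i]]] le_n]|].
  rewrite -(@card_image _ _ (child e) (nodes i0 (n - inc e))) //; last first.
    move=> x x' /set_mem[Vx _ xi] /set_mem[Vx' _ x'i].
    have [y xy _] := edge_lab Vx0 Vx (etrans x0i (esym xi)) x0y0.
    have [y' xy' _] := edge_lab Vx0 Vx' (etrans x0i (esym x'i)) x0y0.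
    rewrite (childE xy) (childE xy') => yy'; rewrite -yy' in xy'.
    by have [-> _] := edge_inj Vx Vx' xy xy'.
    exact: finite_nodes.
  congr card; apply/seteqP.
  split=> [y [[Vy ly yi] [x [Vx xi /= xy]]] | _ [x [Vx lx xi] <-]].
    exists x; last exact: childE.
    by split=> //; have [_] := edge_V Vx xy; rewrite ly => ->; rewrite addnK.
  have [y xy yi] := edge_lab Vx0 Vx (etrans x0i (esym xi)) x0y0.
  have [Vy ly] := edge_V Vx xy.
  rewrite (childE xy); split; last by exists x.
  by split=> //; rewrite ?yi // ly lx subnK.
move=> no; rewrite -[RHS](@card_set0 T); congr card.
apply/seteqP; split=> // y [[Vy ly yi] [x [Vx xi /= xy]]].
move: no; rewrite (_ : leads _ _ = true) /=; last by apply/asboolP; exists x, y.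
by have [_] := edge_V Vx xy; rewrite ly => ->; rewrite leq_addl.
Qed.

Lemma card_nodes i n :
  card (nodes i n) =
  ((n == 0) && (lab root == i) +
   \sum_k (if leads k i && (inc k.2 <= n)
            then card (nodes k.1 (n - inc k.2)) else 0))%N.
Proof.
pose R (k : option ('I_r * E)) : set T := if k is Some k then keyed k else [set root].
rewrite (@card_partition _ _ _ R).
- rewrite (bigD1 None) //=; congr addn.
    case: (boolP (_ && _)) => [/andP[/eqP-> /eqP<-]|no].
      rewrite -[RHS](card_set1 root); congr card.
      by apply/seteqP; split=> [x [_ ->]|x ->].
    rewrite -[RHS](@card_set0 T); congr card.
    apply/seteqP; split=> // x [[_ xn xi] xr].
    by move: no; rewrite -xn -xi xr len_root !eqxx.
  rewrite (reindex_omap Some id) /=; last by case.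
  by apply: eq_big => k; rewrite ?eqxx // => _; exact: card_keyed.
- exact: finite_nodes.
- move=> x [Vx _ _]; case: (V_ex Vx) => [->|[y [e [Vy yex]]]]; first by exists None.
  by exists (Some (lab y, e)); exists y.
- move=> x [k|] [k'|] [Vx _ _] //=; last 2 first.
  + by move=> + xr; rewrite xr => /not_keyed_root.
  + by move=> -> /not_keyed_root.
  move=> [y [Vy yi yx]] [y' [Vy' y'i y'x]]; have [yy' ee'] := edge_inj Vy Vy' yx y'x.
  congr Some; case: k k' yi y'i ee' {yx y'x} => [a b] [a' b'] /= <- <- ->.
  by rewrite yy'.
Qed.

Theorem rational_nodes (i : 'I_r) :
  rational_series (fun n => (card (nodes i n))%:R : rat).
Proof.
pose M : 'M[{poly rat}]_r :=
  \matrix_(i, j) \sum_(e : E) (leads (j, e) i)%:R *: 'X^(inc e).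
pose P (i : 'I_r) : {poly rat} := (lab root == i)%:R%:P.
apply: (@rational_system _ _ M P (fun i n => (card (nodes i n))%:R) _ _ i)
  => [{}i j|N {}i].
  rewrite mxE coef_sum big1 // => e _; rewrite coefZ coefXn.
  by rewrite eq_sym eqn0Ngt inc_gt0 mulr0.
move=> n le_nN; rewrite coef_poly ltnS le_nN card_nodes natrD coefD; congr (_ + _).
  by rewrite coefC; case: (n == 0%N).
rewrite natr_sum coef_sum.
rewrite -(pair_bigA _ (fun j e => (if leads (j, e) i && (inc e <= n)%N
   then card (nodes j (n - inc e)) else 0%N)%:R)) /=.
apply: eq_bigr => j _; rewrite mxE mulr_suml coef_sum; apply: eq_bigr => e _.
rewrite -scalerAl coefZ coefXnM.
case: (leads _ _) => /=; last by rewrite mul0r.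
rewrite mul1r ltnNge; case: (leqP (inc e) n) => //= le_en.
by rewrite coef_poly ltnS (leq_trans (leq_subr _ _) le_nN).
Qed.

End Tree.

(** * Digits and half-lines *)

(** Pairs stand for elements of Z[X]/(X^2 - T X + 1) in the basis 1, X^-1.  In
    this basis [swap], which is the conjugation X |-> X^-1 followed by the
    multiplication by X^-1, exchanges the coordinates: it reflects the line of
    positions about the point that separates the positions -1 and 0. *)
Definition vec : Type := (int * int)%type.
Bind Scope ring_scope with vec.

Lemma vec_ext (u v : vec) : u.1 = v.1 -> u.2 = v.2 -> u = v.
Proof. by case: u v => [a b] [c d] /= -> ->. Qed.

Definition mulX (T : int) (v : vec) : vec := (T * v.1 + v.2, - v.1).
Definition divX (T : int) (v : vec) : vec := (- v.2, v.1 + T * v.2).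
Definition swap (v : vec) : vec := (v.2, v.1).
Definition cst (d : int) : vec := (d, 0).
Definition lin (d : int) : vec := (0, d).

Ltac vec_ring :=
  apply: vec_ext; rewrite /mulX /divX /swap /cst /lin /=; ring.

Section Cost.
Variable T : int.
Implicit Types (u v w y z : vec) (d : int) (j n : nat) (s : seq int).

Local Notation mulX := (mulX T).
Local Notation divX := (divX T).

Lemma mulXK v : divX (mulX v) = v. Proof. vec_ring. Qed.
Lemma divXK v : mulX (divX v) = v. Proof. vec_ring. Qed.

Lemma swapD u v : swap (u + v) = swap u + swap v. Proof. vec_ring. Qed.
Lemma swapK : involutive swap. Proof. by case. Qed.
Lemma swap_divX v : swap (divX v) = mulX (swap v). Proof. vec_ring. Qed.

(** The sum of the d_i X^-i for i >= 1: the digits on the left of the cut, the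
    closest one coming first. *)
Fixpoint tape_val s : vec :=
  if s is d :: s' then divX (tape_val s' + cst d) else 0.

Definition norm1 s : nat := (\sum_(d <- s) `|d|)%N.

Lemma norm1_cons d s : norm1 (d :: s) = (`|d| + norm1 s)%N.
Proof. by rewrite /norm1 big_cons. Qed.

Lemma tape_val_onto n y : exists2 s, (n <= size s)%N & tape_val s = y.
Proof.
elim: n y => [|n IHn] y; last first.
  have [s sz sy] := IHn (mulX y); exists (0 :: s) => //=.
  by rewrite sy -[RHS]mulXK; congr divX; rewrite [cst _]/(0 : vec) addr0.
exists [:: y.2 + T * y.1; - y.1] => //=; vec_ring.
Qed.

(** The cursor crosses every cell twice, as it goes there and comes back, except
    for the j cells closest to the cut, which lie between its initial and final
    positions and are crossed once. *)
Definition tape_cost j s : nat := (norm1 s + (2 * size s - j))%N.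

Definition realizes j y n :=
  exists s, [/\ (j <= size s)%N, tape_val s = y & tape_cost j s = n].

Lemma realizes_ex j y : exists n, `[< realizes j y n >].
Proof.
have [s sz sy] := tape_val_onto j y.
by exists (tape_cost j s); apply/asboolP; exists s.
Qed.

Definition halfcost j y : nat := ex_minn (realizes_ex j y).

Lemma halfcost_attained j y : realizes j y (halfcost j y).
Proof. by rewrite /halfcost; case: ex_minnP => n /asboolP. Qed.

Lemma halfcost_min j y n : realizes j y n -> (halfcost j y <= n)%N.
Proof. by rewrite /halfcost; case: ex_minnP => m _ min_m /asboolP /min_m. Qed.

(** The value 0 is represented for free by the empty tape, and this is the end
    of every tape: giving it a free digit 0 and itself as parent turns
    [halfcost_le] and [optimal_ex] into a recursion without exceptions. *)
Definition stepcost j y : nat :=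
  if j == 0%N then (if y == 0%R then 0 else 2)%N else 1%N.

Lemma halfcost00 : halfcost 0 0 = 0%N.
Proof.
apply/eqP; rewrite -leqn0; apply: halfcost_min; exists [::]; split=> //.
by rewrite /tape_cost /norm1 big_nil.
Qed.

Lemma halfcost_le j w d :
  (halfcost j w <= halfcost j.-1 (mulX w - cst d) + `|d| + stepcost j w)%N.
Proof.
have [s [sz sy <-]] := halfcost_attained j.-1 (mulX w - cst d).
have dsw : tape_val (d :: s) = w by rewrite /= sy subrK mulXK.
case: j => [|j] in s sz sy dsw *; rewrite /stepcost /=.
  have [->|w0] := eqVneq w 0; first by rewrite halfcost00.
  apply: halfcost_min; exists (d :: s); split=> //.
  by rewrite /tape_cost norm1_cons /=; lia.
apply: halfcost_min; exists (d :: s); split=> //.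
by rewrite /tape_cost norm1_cons /=; move: sz => /=; lia.
Qed.

Definition optimal j w d :=
  halfcost j w = (halfcost j.-1 (mulX w - cst d) + `|d| + stepcost j w)%N.

Lemma optimal_ex j w : exists d, optimal j w d.
Proof.
have [s [sz sy sF]] := halfcost_attained j w.
case: s sz sy sF => [|d s] sz sy sF.
  have j0 : j = 0%N by move: sz => /=; lia.
  exists 0; rewrite /optimal -sy j0 /stepcost eqxx.
  have -> : mulX (tape_val [::]) - cst 0 = tape_val [::] by vec_ring.
  by rewrite !addn0.
exists d; apply/eqP; rewrite eqn_leq halfcost_le /=.
have sw : mulX w - cst d = tape_val s by rewrite -sy /= divXK addrK.
have Fs : (halfcost j.-1 (mulX w - cst d) <= tape_cost j.-1 s)%N.
  by apply: halfcost_min; exists s; split=> //; move: sz => /=; lia.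
rewrite -sF; move: Fs sz; rewrite /tape_cost norm1_cons /stepcost /=.
by case: (j) => [|j'] /=; do ?case: ifP => _ /=; lia.
Qed.

(** It suffices to change the digit that is closest to the cut; only the empty
    tape has none, and then a cell is added. *)
Lemma halfcost_lin1 j y d : `|d|%N = 1%N ->
  (halfcost j (y + lin d) <= halfcost j y + (if j == 0%N then 3 else 1))%N.
Proof.
move=> d1; have [e e_opt] := optimal_ex j y.
have := halfcost_le j (y + lin d) (e + d).
have -> : mulX (y + lin d) - cst (e + d) = mulX y - cst e by vec_ring.
move: e_opt; rewrite /optimal /stepcost => ->.
case: (j) => [|j'] /=; last by lia.
case: eqP => [y0|_]; last by case: ifP => _; lia.
by case: ifP => _; lia.
Qed.

(** A half that is not stable has no optimal continuation: a change of its value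
    by one unit would save at least 2, and the digit just beyond the cut can
    compensate it at the price of 1. *)
Definition stable j y :=
  forall d, `|d|%N = 1%N -> (halfcost j y <= halfcost j (y + cst d) + 1)%N.

Lemma optimal_stable j w d : optimal j w d -> stable j.-1 (mulX w - cst d).
Proof.
move=> opt e e1; have := halfcost_le j w (d - e).
rewrite opt.
have -> : mulX w - cst (d - e) = mulX w - cst d + cst e by vec_ring.
lia.
Qed.

(** Here X = T - X^-1 is used: a unit at the cut is traded for T units on the
    closest digit and one on the next. *)
Lemma halfcost_cst1 d j y : `|d|%N = 1%N ->
  (halfcost j (y + cst d) <= halfcost j y + `|T| + 5)%N.
Proof.
move=> d1; have [e e_opt] := optimal_ex j y.
have := halfcost_le j (y + cst d) (e + T * d).
have -> : mulX (y + cst d) - cst (e + T * d) = mulX y - cst e + lin (- d) by vec_ring.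
have := @halfcost_lin1 j.-1 (mulX y - cst e) (- d).
have Td : (`|(e + T * d)%R| <= `|e| + `|T|)%N by nia.
move: e_opt; rewrite /optimal /stepcost => ->.
case: (j) => [|j'] /=; last by case: ifP => _; lia.
by case: ifP => _; case: ifP => _; lia.
Qed.

Lemma stepcost_eq0 j w : stepcost j w = 0%N -> j = 0%N /\ w = 0.
Proof. by rewrite /stepcost; case: j => //=; case: eqP. Qed.

Lemma parent_le j w d : optimal j w d ->
  (halfcost j.-1 (mulX w - cst d) <= halfcost j w)%N.
Proof. by move->; lia. Qed.

Lemma parent_lt j w d : optimal j w d -> (0 < stepcost j w)%N ->
  (halfcost j.-1 (mulX w - cst d) < halfcost j w)%N.
Proof. by move->; lia. Qed.

Definition near v := (`|v.1| <= 2)%N && (`|v.2| <= 2)%N.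

Lemma near0 : near 0. Proof. by []. Qed.

(** Having the same profile.  Levels matter only up to 2: level 0 is where
    cells are crossed twice, and the gluing below requires levels 1 or at least
    2 to be told apart.  At level 0 it must also be known which competitors are
    the empty tape, for these escape the general recursion. *)
Definition similar j y j' y' :=
  minn j 2 = minn j' 2 /\
  forall v, near v ->
    (halfcost j (y + v) + halfcost j' y' =
     halfcost j' (y' + v) + halfcost j y)%N /\
    (j = 0%N -> (y + v = 0 <-> y' + v = 0)).

Lemma similar_sym j y j' y' : similar j y j' y' -> similar j' y' j y.
Proof.
move=> [jj' H]; split=> // v /H [-> H0]; split=> // j0.
have -> // : y' + v = 0 <-> y + v = 0.
by split=> /H0; apply; lia.
Qed.

(** Among the optimal last digits the smallest one is selected, which makes
    every value have a single parent; comparing with a competitor involves only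
    the difference of the digits, that is, the offset. *)
Definition canonical j w d := optimal j w d /\ forall e, optimal j w e -> d <= e.

Lemma canonical_ex j w : exists d, canonical j w d.
Proof.
pose P n := exists2 d, optimal j w d & n = `|(d + halfcost j w)%R|%N.
have [|n /asboolP[d opt dn] n_min] := @ex_minnP (fun n => `[< P n >]).
  have [d opt] := optimal_ex j w.
  by exists `|(d + halfcost j w)%R|%N; apply/asboolP; exists d.
exists d; split=> // e e_opt.
have /asboolP/n_min : P `|(e + halfcost j w)%R|%N by exists e.
by move: e_opt opt; rewrite /optimal; lia.
Qed.

(** A linear form without nonzero root in the box [near]: it orders the
    competitors of a gluing by means of their offsets only. *)
Definition tiebreak v : int := v.1 + 5 * v.2.

Definition total j y z : nat := (halfcost j y + halfcost 1 z)%N.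

Definition minimal j y z :=
  forall v, (total j y z <= total j (y + v) (z - swap v))%N.

(** Linearity of [tiebreak] lets the condition be read as: the left half y has
    the least [tiebreak] among all optimal ways to split y + swap z. *)
Definition best j y z := minimal j y z /\
  forall v, minimal j (y + v) (z - swap v) -> 0 <= tiebreak v.

Lemma minimal_stable j y z : (0 < j)%N -> minimal j y z -> stable j y /\ stable 1 z.
Proof.
case: j => // j _ min_yz; split=> e e1.
  have := min_yz (cst e); rewrite /total.
  have -> : z - swap (cst e) = z + lin (- e) by vec_ring.
  by have := @halfcost_lin1 1 z (- e); rewrite /=; lia.
have := min_yz (lin (- e)); rewrite /total.
have -> : z - swap (lin (- e)) = z + cst e by vec_ring.
by have := @halfcost_lin1 j.+1 y (- e); rewrite /=; lia.
Qed.

Lemma minimal_ex j u : exists y z, minimal j y z /\ u = y + swap z.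
Proof.
pose P n := exists y, n = total j y (swap (u - y)).
have [|n /asboolP[y ->] n_min] := @ex_minnP (fun n => `[< P n >]).
  by exists (total j 0 (swap (u - 0))); apply/asboolP; exists 0.
exists y, (swap (u - y)); split; last by rewrite swapK subrKC.
move=> v; apply: n_min; apply/asboolP; exists (y + v); congr total; vec_ring.
Qed.

Lemma swap_near v : near v -> near (- swap v).
Proof. by rewrite /near /=; lia. Qed.

Hypothesis T5 : 5 <= T.

(** Replacing d by d - T or d + T and compensating on both sides costs at most
    3 on the outer side, where a new cell may be needed, and at most 1 on the
    inner side by stability.  As T > 4, this bounds d. *)
Lemma digit_bound j w d : stable j w -> optimal j w d -> (2 * `|d| <= `|T| + 4)%N.
Proof.
move=> st_w opt; case: (posnP (stepcost j w)) => [inc0 | inc_gt0].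
  have [j0 w0] := stepcost_eq0 inc0; move: opt.
  by rewrite /optimal j0 w0 halfcost00; lia.
have step e : `|e|%N = 1%N -> (`|d| <= `|(d + T * e)%R| + 4)%N.
  move=> e1; have := st_w e e1.
  have := halfcost_le j (w + cst e) (d + T * e).
  have -> : mulX (w + cst e) - cst (d + T * e) = mulX w - cst d + lin (- e) by vec_ring.
  have := @halfcost_lin1 j.-1 (mulX w - cst d) (- e).
  move: inc_gt0; move: opt; rewrite /optimal /stepcost => ->.
  case: (j) => [|j'] /=; last by case: ifP => _; lia.
  by do 2?[case: ifP => _]; lia.
have := step 1 erefl; have := step (-1) erefl; lia.
Qed.

(** An expansion argument.  Stripping one digit from both halves turns the
    offset (p, q) into (T p + q + e, - p) with |e| <= T + 4, hence the first
    coordinate cannot decrease once it is at least 3 and dominates the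
    second one.  But after finitely many steps both halves are empty. *)
Lemma offset_growth j y v : stable j y -> stable j (y + v) ->
  (3 <= `|v.1|)%N -> (`|v.1| < `|v.2|)%N.
Proof.
have [n le_n] := ubnP (halfcost j y + halfcost j (y + v))%N.
elim: n => // n IHn in j y v le_n * => st_y st_yv v1.
have [d dy] := optimal_ex j y; have [d' dyv] := optimal_ex j (y + v).
have := digit_bound st_y dy; have := digit_bound st_yv dyv.
have := optimal_stable dy; have := optimal_stable dyv.
pose v' : vec := (T * v.1 + v.2 + d - d', - v.1).
have -> : mulX (y + v) - cst d' = mulX y - cst d + v' by rewrite /v'; vec_ring.
move=> st_yv' st_y' d'le dle; rewrite ltnNge; apply/negP => v2.
have lt' : (halfcost j.-1 (mulX y - cst d) + halfcost j.-1 (mulX y - cst d + v')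
    < halfcost j y + halfcost j (y + v))%N.
  have := parent_le dy; have := parent_le dyv.
  have := parent_lt dy; have := parent_lt dyv.
  have -> : mulX (y + v) - cst d' = mulX y - cst d + v' by rewrite /v'; vec_ring.
  case: (posnP (stepcost j y)) => [/stepcost_eq0 [j0 y0]|]; last by lia.
  case: (posnP (stepcost j (y + v))) => [/stepcost_eq0 [_ yv0]|]; last by lia.
  by move: v1; rewrite -[v](addKr y) yv0 y0.
have big : (`|v.1| <= `|v'.1|)%N by rewrite /v' /=; nia.
have := IHn j.-1 (mulX y - cst d) v'.
have -> : `|v'.2|%N = `|v.1|%N by rewrite /v' /=; lia.
move=> /(_ _ st_y' st_yv'); lia.
Qed.

(** The optimal digit of any competitor w + v leads, by [offset_growth], to a
    competitor of y in the box, where the profiles of y and y' agree; the same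
    digit is then available to w' + v. *)
Lemma similar_children_le j y j' y' i i' w w' d v :
  similar j y j' y' -> stable j y -> stable j' y' ->
  minn i 2 = minn i' 2 -> i.-1 = j -> i'.-1 = j' ->
  y = mulX w - cst d -> y' = mulX w' - cst d -> near v ->
  (halfcost i' (w' + v) + halfcost j y <= halfcost i (w + v) + halfcost j' y')%N /\
  (i = 0%N -> w + v = 0 -> w' + v = 0).
Proof.
move=> [jj' sim_y] st_y st_y' ii' ij ij' yw yw' v_near.
have [e e_opt] := optimal_ex i (w + v).
pose u : vec := (T * v.1 + v.2 + d - e, - v.1).
have yu : mulX (w + v) - cst e = y + u by rewrite yw /u; vec_ring.
have yu' : mulX (w' + v) - cst e = y' + u by rewrite yw' /u; vec_ring.
have u_near : near u.
  have := optimal_stable e_opt; rewrite yu ij => st_yu.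
  have := offset_growth st_y st_yu; move: v_near; rewrite /near /u /=; lia.
have [Fu zu] := sim_y _ u_near.
have root : i = 0%N -> w + v = 0 -> w' + v = 0.
  move=> i0 wv0; move: e_opt; rewrite /optimal wv0 i0 halfcost00 => e0.
  have {}e0 : e = 0 by lia.
  have : y + u = 0 by rewrite -yu wv0 e0; vec_ring.
  move/zu => -/(_ _); rewrite -yu' e0 => h.
  have {}h : mulX (w' + v) = 0.
    by rewrite -[LHS]subr0 -[RHS]h; [|lia]; congr (_ - _).
  by rewrite -[LHS]mulXK h; vec_ring.
split=> //.
have := halfcost_le i' (w' + v) e; rewrite yu' ij'.
move: e_opt; rewrite /optimal yu ij => ->.
suff : (stepcost i' (w' + v) <= stepcost i (w + v))%N by lia.
rewrite /stepcost; case: (i) ii' root => [|i0]; case: (i') => [|i0'] //= eii root;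
  try by lia.
case: eqP => // w'0; case: eqP => // /(root erefl) /w'0 [].
Qed.

Lemma similar_children j y j' y' i i' d :
  similar j y j' y' -> stable j y -> stable j' y' ->
  minn i 2 = minn i' 2 -> i.-1 = j -> i'.-1 = j' ->
  let w := divX (y + cst d) in let w' := divX (y' + cst d) in
  (0 < stepcost i w)%N -> stable i w -> canonical i w d ->
  [/\ (0 < stepcost i' w')%N, stable i' w', canonical i' w' d & similar i w i' w'].
Proof.
move=> yy' st_y st_y' ii' ij ij' w w' inc_gt0 st_w [opt_d min_d].
have yw : y = mulX w - cst d by rewrite divXK addrK.
have yw' : y' = mulX w' - cst d by rewrite divXK addrK.
have H v (hv : near v) := similar_children_le yy' st_y st_y' ii' ij ij' yw yw' hv.
have yy's := similar_sym yy'.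
have H' v (hv : near v) :=
  similar_children_le yy's st_y' st_y (esym ii') ij' ij yw' yw hv.
have nroot' : (0 < stepcost i' w')%N.
  rewrite lt0n; apply/eqP => /stepcost_eq0 [i'0 w'0].
  have i0 : i = 0%N by move: ii'; rewrite i'0; lia.
  have [_ /(_ i'0)] := H' 0 near0; rewrite !addr0 => /(_ w'0) w0.
  by move: inc_gt0; rewrite i0 w0.
have ieq : stepcost i w = stepcost i' w'.
  move: inc_gt0 nroot' ii'; rewrite /stepcost.
  by case: (i) => [|a]; case: (i') => [|b] //=; do 2?[case: ifP => //]; lia.
have sim_ww' : similar i w i' w'.
  split=> // v v_near.
  have [h1 r1] := H _ v_near; have [h2 r2] := H' _ v_near.
  have [h3 r3] := H 0 near0; have [h4 r4] := H' 0 near0.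
  rewrite !addr0 in h3 h4; split; first by lia.
  move=> i0; split; first exact: r1.
  by apply: r2; move: ii'; rewrite i0; lia.
have opt' : optimal i' w' d.
  have [h _] := H' 0 near0; have := halfcost_le i' w' d.
  move: h opt_d; rewrite !addr0 /optimal -yw -yw' ieq ij ij'; lia.
have Fww' v (hv : near v) :
    (halfcost i (w + v) + halfcost i' w' = halfcost i' (w' + v) + halfcost i w)%N.
  by have [_ /(_ v hv)[]] := sim_ww'.
split=> //.
- move=> e e1; have := st_w e e1; have := Fww' (cst e).
  by rewrite /near /cst /=; lia.
- split=> // e opt_e; rewrite leNgt; apply/negP => e_lt.
  have := min_d e; suff : optimal i w e by move=> h /(_ h); lia.
  pose u : vec := cst (d - e).
  have yu' : mulX w' - cst e = y' + u by rewrite yw' /u; vec_ring.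
  have yu : mulX w - cst e = y + u by rewrite yw /u; vec_ring.
  have u_near : near u.
    have := optimal_stable opt_e; rewrite yu' ij' => st_yu.
    have := offset_growth st_y' st_yu; rewrite /near /u /=; lia.
  have [_ /(_ u u_near)[Fu _]] := yy'.
  move: opt_e opt' opt_d; rewrite /optimal yu yu' ij ij' -yw -yw'; lia.
Qed.

(** The mirror image exchanges the coordinates of the offset, so that
    [offset_growth] on both sides leaves only the box. *)
Lemma minimal_near j y z v : (0 < j)%N -> stable j y -> stable 1 z ->
  minimal j (y + v) (z - swap v) -> near v.
Proof.
move=> j0 st_y st_z min_v; have [st_yv st_zv] := minimal_stable j0 min_v.
have := offset_growth st_y st_yv; have := offset_growth st_z st_zv.
by rewrite /near /=; lia.
Qed.

Lemma best_ex j u : (0 < j)%N -> exists y z, best j y z /\ u = y + swap z.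
Proof.
move=> j0; have [y [z [min_yz uyz]]] := minimal_ex j u.
have [st_y st_z] := minimal_stable j0 min_yz.
pose P n := exists2 v, minimal j (y + v) (z - swap v) & n = `|(tiebreak v + 12)%R|%N.
have [|n /asboolP[v min_v dn] n_min] := @ex_minnP (fun n => `[< P n >]).
  exists 12%N; apply/asboolP; exists 0 => //.
  have -> : z - swap 0 = z by vec_ring.
  by rewrite addr0.
exists (y + v), (z - swap v); split; last by rewrite uyz; vec_ring.
split=> // v' min_v'.
have e1 : y + v + v' = y + (v + v') by rewrite addrA.
have e2 : z - swap v - swap v' = z - swap (v + v') by vec_ring.
rewrite e1 e2 in min_v'.
have near_v' := minimal_near j0 st_y st_z min_v'.
have near_v := minimal_near j0 st_y st_z min_v.
have /asboolP/n_min : P `|(tiebreak (v + v') + 12)%R|%N by exists (v + v').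
by move: near_v near_v'; rewrite dn /near /tiebreak /=; lia.
Qed.

Lemma best_unique j y z y' z' : (0 < j)%N -> best j y z -> best j y' z' ->
  y + swap z = y' + swap z' -> y = y' /\ z = z'.
Proof.
move=> j0 [min_yz w_yz] [min' w'] e; pose v := y' - y.
have ey : y' = y + v by rewrite /v subrKC.
have ez : z' = z - swap v.
  by rewrite -[z']swapK -[z in RHS]swapK -[swap z'](addKr y') -e ey; vec_ring.
have [st_y st_z] := minimal_stable j0 min_yz.
have v_near : near v by apply: (@minimal_near j y z) => //; rewrite -ey -ez.
have wv : 0 <= tiebreak v by apply: w_yz; rewrite -ey -ez.
have w_v : 0 <= tiebreak (- v).
  apply: w'; rewrite ey ez.
  have -> : y + v - v = y by rewrite addrK.
  by have -> : z - swap v - swap (- v) = z by vec_ring.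
have v0 : v = 0.
  by apply: vec_ext; move: v_near wv w_v; rewrite /near /tiebreak /=; lia.
rewrite ey ez v0; split; vec_ring.
Qed.

(** Every optimal split is within the box around y' by [minimal_near], so that
    comparing it with (y', z') amounts to a comparison of splits near (y, z). *)
Lemma best_similar j y z j' y' z' : (0 < j)%N -> (0 < j')%N ->
  similar j y j' y' -> similar 1 z 1 z' -> stable j' y' -> stable 1 z' ->
  best j y z -> best j' y' z'.
Proof.
move=> j0 j'0 [_ sy] [_ sz] st_y' st_z' [min_yz w_yz].
have eq_total v : near v ->
  (total j (y + v) (z - swap v) + total j' y' z' =
   total j' (y' + v) (z' - swap v) + total j y z)%N.
  move=> nv; have [+ _] := sy _ nv; have [+ _] := sz _ (swap_near nv).
  by rewrite /total; lia.
have [y2 [z2 [min2 e2]]] := minimal_ex j' (y' + swap z').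
pose u := y2 - y'; have ey2 : y2 = y' + u by rewrite /u subrKC.
have ez2 : z2 = z' - swap u.
  by rewrite -[z2]swapK -[z' in RHS]swapK -[swap z2](addKr y2) -e2 ey2; vec_ring.
rewrite ey2 ez2 in min2.
have near_u := minimal_near j'0 st_y' st_z' min2.
have min' : minimal j' y' z'.
  move=> v; apply: (@leq_trans (total j' (y' + u) (z' - swap u))).
    by have := eq_total u near_u; have := min_yz u; lia.
  have := min2 (v - u); congr (_ <= total _ _ _)%N; vec_ring.
split=> // v min_v; apply: w_yz.
have near_v := minimal_near j'0 st_y' st_z' min_v.
move=> x; apply: (@leq_trans (total j y z)).
  have := eq_total v near_v; have := min_v (- v).
  have -> : y' + v - v = y' by rewrite addrK.
  have -> : z' - swap v - swap (- v) = z' by vec_ring.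
  lia.
have := min_yz (v + x); congr (_ <= total _ _ _)%N; vec_ring.
Qed.

End Cost.

(** * Finitely many profiles *)

Section Nodes.
Variable T : int.
Hypothesis T5 : 5 <= T.
Implicit Types (u v w y z : vec) (d : int) (i j n : nat) (x : nat * vec).

Lemma halfcost_cst_le j y d :
  (halfcost T j (y + cst d) <= halfcost T j y + `|d| * (`|T| + 5))%N.
Proof.
have [n] := ubnP `|d|%N; elim: n => // n IHn in d *; rewrite ltnS => dn.
have [->|d0] := eqVneq d 0; first by rewrite [cst 0]/(0 : vec) addr0 leq_addr.
pose e : int := if 0 < d then 1 else -1.
have e1 : `|e|%N = 1%N by rewrite /e; case: ifP.
have de : `|d|%N = (`|(d - e)%R|).+1 by rewrite /e; case: ifP; lia.
have := halfcost_cst1 T j (y + cst (d - e)) e1; have := IHn (d - e).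
have -> : y + cst (d - e) + cst e = y + cst d by vec_ring.
by rewrite de mulSn; lia.
Qed.

Lemma halfcost_lin_le j y d :
  (halfcost T j (y + lin d) <= halfcost T j y + `|d| * 3)%N.
Proof.
have [n] := ubnP `|d|%N; elim: n => // n IHn in d *; rewrite ltnS => dn.
have [->|d0] := eqVneq d 0; first by rewrite [lin 0]/(0 : vec) addr0 leq_addr.
pose e : int := if 0 < d then 1 else -1.
have e1 : `|e|%N = 1%N by rewrite /e; case: ifP.
have de : `|d|%N = (`|(d - e)%R|).+1 by rewrite /e; case: ifP; lia.
have := @halfcost_lin1 T j (y + lin (d - e)) e e1; have := IHn (d - e).
have -> : y + lin (d - e) + lin e = y + lin d by vec_ring.
by rewrite de mulSn; case: ifP; lia.
Qed.

Definition lip : nat := (2 * (`|T| + 5) + 2 * 3)%N.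

Lemma halfcost_near_le j y v : near v ->
  (halfcost T j (y + v) <= halfcost T j y + lip)%N.
Proof.
move=> /andP[v1 v2]; have -> : y + v = y + cst v.1 + lin v.2 by vec_ring.
apply: leq_trans (halfcost_lin_le _ _ _) _; rewrite /lip addnA leq_add ?leq_mul //.
apply: leq_trans (halfcost_cst_le _ _ _) _; by rewrite leq_add ?leq_mul.
Qed.

Lemma halfcost_near_ge j y v : near v ->
  (halfcost T j y <= halfcost T j (y + v) + lip)%N.
Proof.
move=> nv; have := @halfcost_near_le j (y + v) (- v); rewrite addrK; apply.
by move: nv; rewrite /near /=; lia.
Qed.

Definition shift_vec (p : 'I_5 * 'I_5) : vec := ((p.1 : nat)%:Z - 2, (p.2 : nat)%:Z - 2).

Definition type_of x : 'I_3 * {ffun 'I_5 * 'I_5 -> 'I_(2 * lip).+1 * bool} :=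
  (inord (minn x.1 2),
   [ffun p => (inord (halfcost T x.1 (x.2 + shift_vec p) + lip - halfcost T x.1 x.2),
               (x.1 == 0%N) && (x.2 + shift_vec p == 0))]).

Lemma shift_near p : near (shift_vec p).
Proof. by case: p => [[a ha] [b hb]]; rewrite /near /shift_vec /=; lia. Qed.

Lemma near_shift v : near v -> exists p, v = shift_vec p.
Proof.
move=> nv; exists (inord `|(v.1 + 2)%R|, inord `|(v.2 + 2)%R|).
by move: nv; rewrite /near => ?; apply: vec_ext; rewrite /= inordK; lia.
Qed.

Lemma type_ofP x x' : type_of x = type_of x' <-> similar T x.1 x.2 x'.1 x'.2.
Proof.
case: x x' => [j y] [j' y']; rewrite /type_of /=; split=> [[jj' pp']|[jj' yy']].
  have {}jj' : minn j 2 = minn j' 2.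
    by move/(congr1 val): jj'; rewrite /= !inordK; lia.
  split=> // v /[dup] nv /near_shift[p vp].
  have := congr1 (fun f : {ffun _} => f p) pp'; rewrite !ffunE -vp => -[].
  move/(congr1 val); rewrite /=.
  have := halfcost_near_le j y nv; have := halfcost_near_ge j y nv.
  have := halfcost_near_le j' y' nv; have := halfcost_near_ge j' y' nv.
  move=> h1 h2 h3 h4; rewrite !inordK; try lia.
  move=> e1 e2; split; first by lia.
  move=> j0; move: e2; have -> : j' = 0%N by move: jj'; rewrite j0; lia.
  by rewrite j0 /= => e2; split=> /eqP h; apply/eqP; rewrite ?e2 // -e2.
congr (_, _); first by rewrite jj'.
apply/ffunP => p; rewrite !ffunE; have [F_eq z_eq] := yy' _ (shift_near p).
congr (_, _).
  congr inord; have := halfcost_near_ge j y (shift_near p).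
  have := halfcost_near_ge j' y' (shift_near p).
  lia.
have -> : (j' == 0%N) = (j == 0%N) by move: jj'; case: (j); case: (j') => //; lia.
by case: eqP => //= /z_eq zz; apply/eqP/eqP => /zz.
Qed.

Definition types : nat :=
  #|{: 'I_3 * {ffun 'I_5 * 'I_5 -> 'I_(2 * lip).+1 * bool}}|.

Definition lab x : 'I_types := enum_rank (type_of x).

Lemma labP x x' : lab x = lab x' <-> similar T x.1 x.2 x'.1 x'.2.
Proof. by rewrite -type_ofP; split=> [/enum_rank_inj//|]; rewrite /lab => ->. Qed.

Definition dmax : nat := (`|T| + 4)%N.
Definition move_type : finType := ('I_(2 * dmax).+1 * bool)%type.
Definition digit (e : move_type) : int := (e.1 : nat)%:Z - dmax%:Z.
Definition move_inc (e : move_type) : nat :=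
  (`|digit e| + (if e.2 then 1 else 2))%N.

(** The flag of a move tells whether the level increases; a cell crossed twice
    can only be added at level 0. *)
Definition extends x (e : move_type) x' : Prop :=
  [/\ e.2 || (x.1 == 0%N),
      x' = (if e.2 then x.1.+1 else 0%N, divX T (x.2 + cst (digit e))),
      (0 < stepcost x'.1 x'.2)%N, stable T x'.1 x'.2
    & canonical T x'.1 x'.2 (digit e)].

Definition live : set (nat * vec) := [set x | stable T x.1 x.2].
Definition len x : nat := halfcost T x.1 x.2.

Notation nodes := (nodes live len lab).

Lemma move_inc_gt0 e : (0 < move_inc e)%N.
Proof. by rewrite /move_inc; case: ifP; lia. Qed.

Lemma extends_live x e x' : live x -> extends x e x' ->
  live x' /\ len x' = (len x + move_inc e)%N.
Proof.
move=> lx [x_e x'E i0 st_x' [opt _]]; split=> //.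
rewrite /len opt /move_inc; move: i0; rewrite x'E /= divXK addrK.
by move: x_e; case: e.2 => /=; rewrite /stepcost /=; [|move/eqP->; case: ifP]; lia.
Qed.

Lemma extends_fun x e x' x'' : extends x e x' -> extends x e x'' -> x' = x''.
Proof. by move=> [_ -> _ _ _] [_ -> _ _ _]. Qed.

Lemma extends_inj x e x' e' x'' :
  live x -> live x' -> extends x e x'' -> extends x' e' x'' -> x = x' /\ e = e'.
Proof.
case: x x' e e' => [i a] [i' a'] [d b] [d' b'] _ _.
move=> [/= e_ok -> i0 st_y [o c]] [/= e'_ok yE _ _ [/= o' c']].
have dd' : digit (d, b) = digit (d', b') by apply/eqP; rewrite eq_le c // c'.
have aa' : divX T (a + cst (digit (d, b))) = divX T (a' + cst (digit (d', b'))).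
  exact: (congr1 snd yE).
have {yE} ii' := congr1 fst yE; rewrite /= in ii'.
have {}aa' : a = a'.
  by apply: (addIr (cst (digit (d, b)))); rewrite -[LHS](divXK T) aa' divXK dd'.
have bb' : b = b' by move: ii'; case: (b); case: (b').
subst a' b'; split.
  by congr (_, _); move: ii' e_ok e'_ok; case: (b) => /= [[]|_ /eqP-> /eqP->].
by congr (_, _); apply: val_inj; move: dd'; rewrite /digit /=; lia.
Qed.

Lemma live_ex x' : live x' ->
  x' = (0%N, 0) \/ exists x e, live x /\ extends x e x'.
Proof.
case: x' => [j w] st_w.
case: (posnP (stepcost j w)) => [/stepcost_eq0[-> ->]|inc_gt0]; first by left.
right; have [d cd] := canonical_ex T j w; have [opt _] := cd.
have dle := digit_bound T5 st_w opt.
pose e : move_type := (inord `|(d + dmax%:Z)%R|, j != 0%N).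
have de : digit e = d by rewrite /digit /= inordK /dmax; lia.
exists (j.-1, mulX T w - cst d), e; split; first exact: optimal_stable.
split=> //=; rewrite ?de //; first by case: (j).
by rewrite subrK mulXK; case: (j).
Qed.

Lemma live_root : live (0%N, 0).
Proof. by move=> d _; rewrite halfcost00. Qed.

Lemma extends_lab x x' e (p : nat * vec) : live x -> live x' -> lab x = lab x' ->
  extends x e p -> exists2 p', extends x' e p' & lab p' = lab p.
Proof.
case: x x' => [i a] [i' a'] Qa Qa' /labP /= aa' [/= e_ok -> /= i0 st_y cy].
have [ii' _] := aa'.
have e_ok' : e.2 || (i' == 0%N) by move: e_ok ii'; case: e.2 => //= /eqP->; lia.
have := similar_children T5 aa' Qa Qa' _ _ _ i0 st_y cy.
move=> /(_ (if e.2 then i'.+1 else 0%N)) [].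
- by move: ii'; case: e.2 => //; lia.
- by move: e_ok; case: e.2 => //= /eqP->.
- by move: e_ok'; case: e.2 => //= /eqP->.
move=> i0' st_y' cy' yy'.
exists (if e.2 then i'.+1 else 0%N, divX T (a' + cst (digit e))) => //.
by apply/labP/similar_sym.
Qed.

Lemma rational_live (i : 'I_types) :
  rational_series (fun n => (card (nodes i n))%:R : rat).
Proof.
apply: (rational_nodes move_inc_gt0 extends_live extends_fun extends_inj live_ex
  live_root _ extends_lab).
exact: halfcost00.
Qed.

Lemma finite_live n : finite_set [set x | live x /\ (len x <= n)%N].
Proof. exact: (finite_ball move_inc_gt0 extends_live extends_fun live_ex). Qed.

Lemma finite_live_nodes (c : 'I_types) n : finite_set (nodes c n).
Proof. by apply: sub_finite_set (finite_live n) => x [Vx <- _]. Qed.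

(** * Gluing two half-lines *)

(** A node (j, u) stands for the pair of the value u seen from the final
    position of the cursor and of j - 1, the distance between the initial
    and final positions. *)
Definition gluings (J n : nat) : set (nat * vec) := [set x | (J <= x.1)%N /\
  exists y z, [/\ minimal T x.1 y z, x.2 = y + swap z & total T x.1 y z = n]].

Definition glue (p : (nat * vec) * (nat * vec)) : nat * vec :=
  (p.1.1, p.1.2 + swap p.2.2).

Definition glueable J (i1 i2 : 'I_types) : bool := `[< exists j y z,
  [/\ (J <= j)%N, lab (j, y) = i1, lab (1%N, z) = i2 & best T j y z] >].

Lemma glueableP J (i1 i2 : 'I_types) j y j2 z :
  (1 <= J <= 2)%N -> glueable J i1 i2 ->
  stable T j y -> stable T j2 z -> lab (j, y) = i1 -> lab (j2, z) = i2 ->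
  [/\ j2 = 1%N, (J <= j)%N & best T j y z].
Proof.
move=> J12 /asboolP[j0 [y0 [z0 [Jj0 y01 z02 b0]]]] st_y st_z y1 z2.
have sy : similar T j0 y0 j y by apply/(labP (j0, y0) (j, y)); rewrite y01.
have sz : similar T 1 z0 j2 z by apply/(labP (1%N, z0) (j2, z)); rewrite z02.
have j21 : j2 = 1%N by have [] := sz; lia.
have Jj : (J <= j)%N by have [] := sy; lia.
split=> //; subst j2.
apply: (best_similar T5 _ _ sy sz) => //; lia.
Qed.

(** Each element has exactly one [best] splitting; it is classified by the two
    profiles and by the cost of the left half. *)
Lemma card_gluings J n : (1 <= J <= 2)%N ->
  card (gluings J n) = (\sum_(k : 'I_types * 'I_types)
    if glueable J k.1 k.2 then
      \sum_(p < n.+1) card (nodes k.1 p) * card (nodes k.2 (n - p)) else 0)%N.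
Proof.
move=> J12.
have J0 j : (J <= j)%N -> (0 < j)%N by lia.
pose R (k : ('I_types * 'I_types) * 'I_n.+1) : set (nat * vec) :=
  [set x | exists y z,
  [/\ best T x.1 y z, x.2 = y + swap z,
      lab (x.1, y) = k.1.1, lab (1%N, z) = k.1.2 & halfcost T x.1 y = k.2]].
have best_total j y z y' z' :
    best T j y z -> minimal T j y' z' -> y + swap z = y' + swap z' ->
    total T j y z = total T j y' z'.
  move=> [m _] m' e; have := m (y' - y); have := m' (y - y').
  have -> : y' + (y - y') = y by vec_ring.
  have -> : y + (y' - y) = y' by vec_ring.
  have -> : z' - swap (y - y') = z.
    rewrite -[z']swapK -[swap z'](addKr y') -e -[z in RHS]swapK; vec_ring.
  have -> : z - swap (y' - y) = z'.
    rewrite -[z]swapK -[swap z](addKr y) e -[z' in RHS]swapK; vec_ring.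
  by lia.
rewrite (@card_partition _ _ _ R).
- rewrite -(pair_bigA _ (fun k p => card (gluings J n `&` R (k, p)))) /=.
  apply: eq_bigr => -[i1 i2] _ /=; case: ifP => [glue12|no].
    apply: eq_bigr => p _; rewrite -card_prod; [|exact: finite_live_nodes..].
    rewrite -(@card_image _ _ glue (nodes i1 p `*` nodes i2 (n - p))); first 1 last.
    + by apply: finite_setX; exact: finite_live_nodes.
    + move=> [[j y] [j2 z]] [[j' y'] [j2' z']] /set_mem[[st_y _ yi] [st_z _ zi]].
      move=> /set_mem[[st_y' _ yi'] [st_z' _ zi']] gg.
      have e : y + swap z = y' + swap z' := congr1 snd gg.
      have {gg} jj' : j = j' := congr1 fst gg.
      have [j21 Jj b] := glueableP J12 glue12 st_y st_z yi zi.
      have [j21' Jj' b'] := glueableP J12 glue12 st_y' st_z' yi' zi'.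
      subst j'; move: j21 j21' => /= -> ->.
      by have [/= -> ->] := best_unique T5 (J0 _ Jj) b b' e.
    congr card; apply/seteqP; split.
      move=> [j u] [[/= Jj [y' [z' [m' u' t']]]] [y [z [/= b uyz yi zi Fy]]]].
      have [st_y st_z] := minimal_stable (J0 _ Jj) b.1.
      exists ((j, y), (1%N, z)); last by rewrite uyz.
      split; first by split.
      split=> //; have := best_total _ _ _ _ _ b m'; rewrite -uyz => /(_ u').
      by rewrite t' /total /len /= Fy; lia.
    move=> _ [[[j y] [j2 z]] /= [[st_y Fy yi] [st_z Fz zi]] <-].
    have [j21 Jj b] := glueableP J12 glue12 st_y st_z yi zi.
    rewrite /= in j21 Jj b; subst j2.
    have pn : (p <= n)%N by rewrite -ltnS.
    split; last by exists y, z; split.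
    split=> //; exists y, z; split=> //; first exact: b.1.
    by move: Fy Fz; rewrite /total /len /= => -> ->; rewrite subnKC.
  rewrite big1 // => p _; rewrite -[RHS](@card_set0 (nat * vec)%type); congr card.
  apply/seteqP; split=> // -[j u] [[/= Jj _] [y [z [/= b uyz yi zi Fy]]]].
  by move/asboolP: no; apply; exists j, y, z; split.
- apply: (@sub_finite_set _ _ (glue @`
    ([set x | live x /\ (len x <= n)%N] `*` [set x | live x /\ (len x <= n)%N]))).
    move=> [j u] /= [Jj [y [z [m uyz t]]]].
    have [st_y st_z] := minimal_stable (J0 _ Jj) m.
    exists ((j, y), (1%N, z)); last by rewrite /glue /= -uyz.
    by move: t; rewrite /total /= => t; split; split=> //=; rewrite /len /=; lia.
  by apply: finite_image; apply: finite_setX; exact: finite_live.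
- move=> [j u] /= [Jj [y' [z' [m' u' t']]]].
  have [y [z [b uyz]]] := best_ex T5 u (J0 _ Jj).
  have Fy : (halfcost T j y < n.+1)%N.
    have := best_total _ _ _ _ _ b m'; rewrite -uyz => /(_ u').
    by rewrite t' /total /=; lia.
  by exists ((lab (j, y), lab (1%N, z)), Ordinal Fy), y, z.
- move=> [j u] [[i1 i2] p] [[i1' i2'] p'] /= [Jj _].
  move=> [y [z [/= b uyz <- <- Fy]]] [y' [z' [/= b' uyz' <- <- Fy']]].
  have [yy' zz'] := best_unique T5 (J0 _ Jj) b b' (etrans (esym uyz) uyz').
  by subst y' z'; congr (_, _); apply: val_inj; rewrite /= -Fy -Fy'.
Qed.

Theorem rational_gluings J : (1 <= J <= 2)%N ->
  rational_series (fun n => (card (gluings J n))%:R : rat).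
Proof.
move=> J12; pose f (k : 'I_types * 'I_types) n : rat :=
  if glueable J k.1 k.2 then
    \sum_(p < n.+1) (card (nodes k.1 p))%:R * (card (nodes k.2 (n - p)))%:R else 0.
apply: (@eq_rational _ (fun n => \sum_k f k n)).
  move=> n; rewrite card_gluings // natr_sum; apply: eq_bigr => k _; rewrite /f.
  by case: ifP => // _; rewrite natr_sum; apply: eq_bigr => p _; rewrite natrM.
apply: rational_sum => k; rewrite /f.
case: (glueable J k.1 k.2); last exact: rational0.
exact: rationalM (rational_live k.1) (rational_live k.2).
Qed.

End Nodes.

(** * Configurations of the cursor *)

Section Config.
Variable T : int.
Implicit Types (u v w y z : vec) (d e m : int) (n : nat) (s : seq int).

(** The cell of the letter a is the head of the first tape, and that of b is the
    head of the second one.  The initial position is m cells to the left of the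
    cursor, so it has to be covered by one of the tapes.  The two tapes have
    size s + size s' - 2 gaps in the reach of the cursor, each of which is
    crossed twice, except for the |m| gaps between the end points. *)
Definition config m u n := exists s s',
  [/\ m + 1 <= (size s)%:Z /\ 1 - m <= (size s')%:Z,
      (0 < size s)%N /\ (0 < size s')%N, u = tape_val T s + swap (tape_val T s')
    & (n + 4 + `|m| = norm1 s + norm1 s' + 2 * (size s + size s'))%N].

Lemma config_sym m u n : config m u n -> config (- m) (swap u) n.
Proof.
move=> [s [s' [[h1 h2] [h3 h4] -> h5]]]; exists s', s; split; [lia|lia| |lia].
by rewrite swapD swapK addrC.
Qed.

Definition step m u m' u' :=
  [\/ m' = m /\ (exists2 e, `|e|%N = 1%N & u' = u + lin e \/ u' = u + cst e),
      m' = m + 1 /\ u' = divX T u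
    | m' = m - 1 /\ u' = mulX T u].

Lemma step_sym m u m' u' : step m u m' u' ->
  step (- m) (swap u) (- m') (swap u').
Proof.
case=> -[->].
- move=> [e e1 [] ->]; apply: Or31; split=> //; exists e => //;
    rewrite swapD; by [right | left].
- by move=> ->; apply: Or33; split; [ring | vec_ring].
- by move=> ->; apply: Or32; split; [ring | vec_ring].
Qed.

Lemma config_lin m u n e : `|e|%N = 1%N -> config m u n ->
  exists2 n', (n' <= n.+1)%N & config m (u + lin e) n'.
Proof.
move=> e1 [[|d s] [s' [[h1 h2] [h3 h4] -> h5]]] //.
move: h1 h3 h5; rewrite norm1_cons /= => h1 h3 h5.
exists (n + `|(d + e)%R| - `|d|)%N; first by lia.
exists (d + e :: s), s'; split=> //=; first by vec_ring.
by rewrite norm1_cons; lia.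
Qed.

Lemma config_t m u n : config m u n ->
  exists2 n', (n' <= n.+1)%N & config (m + 1) (divX T u) n'.
Proof.
move=> [s [[|d s'] [[h1 h2] [h3 h4] -> h5]]] //.
move: h2 h4 h5; rewrite norm1_cons /= => h2 h4 h5.
have [s'0|s'0] := posnP (size s').
  exists n.+1 => //; exists (d :: s), [:: 0].
  rewrite !norm1_cons /= /norm1 big_nil.
  move: h2 h5; have -> : s' = [::] by case: (s') s'0.
  rewrite /= /norm1 big_nil => h2 h5; split; [lia | by [] | by vec_ring | lia].
exists (n + `|m| - `|(m + 1)%R|)%N; first by lia.
exists (d :: s), s'; rewrite norm1_cons /=; split; [lia | lia | by vec_ring | lia].
Qed.

Lemma config_step m u n m' u' : step m u m' u' -> config m u n ->
  exists2 n', (n' <= n.+1)%N & config m' u' n'.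
Proof.
case=> -[->].
- move=> [e e1 [] ->]; first exact: config_lin.
  move=> /config_sym/(config_lin e1)[n' n'n /config_sym c]; exists n' => //.
  by move: c; rewrite opprK swapD swapK.
- by move=> ->; exact: config_t.
- move=> -> /config_sym/config_t[n' n'n /config_sym c]; exists n' => //.
  by move: c; rewrite swap_divX swapK opprD opprK.
Qed.

(** Remove a nonzero digit within reach.  If there is none, move away from the
    initial position as long as the tape extends there; otherwise walk back
    towards it, discarding the empty cell that is left behind.  At the initial
    position, move to a side on which cells remain. *)
Lemma config_descent m u n : config m u n ->
  [/\ m = 0, u = 0 & n = 0%N] \/
  exists m' u' n', [/\ step m u m' u', config m' u' n' & n = n'.+1].
Proof.
wlog m0 : m u / 0 <= m.
  move=> H; have [m0|mlt0] := leP 0 m; first exact: H.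
  move=> /config_sym c.
  have [|[h1 h2 h3]|[m' [u' [n' [st c' nn']]]]] := H _ _ _ c; first by lia.
    by left; split=> //; [lia | rewrite -[u]swapK h2].
  right; exists (- m'), (swap u'), n'; split=> //; last exact: config_sym.
  by have := step_sym st; rewrite opprK swapK.
move=> [[|d s] [[|d' s'] [[h1 h2] [h3 h4] -> h5]]] //.
move: h1 h2 h3 h4 h5; rewrite !norm1_cons [size (_ :: _)]/= [size (d' :: _)]/=.
move=> h1 h2 _ _ h5.
have [d0|d0] := eqVneq d 0; last first.
  pose e : int := if 0 < d then -1 else 1.
  right; exists m, (tape_val T (d :: s) + swap (tape_val T (d' :: s')) + lin e), n.-1.
  split.
  - by apply: Or31; split=> //; exists e; [rewrite /e; case: ifP | left].
  - exists (d + e :: s), (d' :: s'); rewrite !norm1_cons; split=> //=; first by vec_ring.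
    by rewrite /e; case: ifP; lia.
  - lia.
have [d'0|d'0] := eqVneq d' 0; last first.
  pose e : int := if 0 < d' then -1 else 1.
  right; exists m, (tape_val T (d :: s) + swap (tape_val T (d' :: s')) + cst e), n.-1.
  split.
  - by apply: Or31; split=> //; exists e; [rewrite /e; case: ifP | right].
  - exists (d :: s), (d' + e :: s'); rewrite !norm1_cons; split=> //=; first by vec_ring.
    by rewrite /e; case: ifP; lia.
  - lia.
have tape0 : tape_val T (d :: s) + swap (tape_val T (d' :: s')) =
    divX T (tape_val T s) + swap (divX T (tape_val T s')).
  by rewrite /= d0 d'0 [cst 0]/(0 : vec) !addr0.
rewrite tape0.
have [s'0|s'0] := posnP (size s'); last first.
  right; exists (m + 1).
  exists (divX T (divX T (tape_val T s) + swap (divX T (tape_val T s')))), n.-1.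
  split; [by apply: Or32 | | lia].
  exists (d' :: d :: s), s'; rewrite !norm1_cons /= d0 d'0.
  by split; [lia | lia | vec_ring | lia].
have s'E : s' = [::] by case: (s') s'0.
move: h2 h5; rewrite s'E /= /norm1 big_nil -/(norm1 s) => h2 h5.
have [m00|m00] := eqVneq m 0; last first.
  right; exists (m - 1), (mulX T (divX T (tape_val T s) + swap (divX T 0))), n.-1.
  split; [by apply: Or33 | | lia].
  exists s, [:: 0]; rewrite norm1_cons /= /norm1 big_nil -/(norm1 s).
  by split; [lia | lia | vec_ring | lia].
have [s0|s0] := posnP (size s); last first.
  right; exists (m - 1), (mulX T (divX T (tape_val T s) + swap (divX T 0))), n.-1.
  split; [by apply: Or33 | | lia].
  exists s, [:: d; d']; rewrite !norm1_cons /= /norm1 big_nil -/(norm1 s) d0 d'0.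
  by split; [lia | lia | vec_ring | lia].
have sE : s = [::] by case: (s) s0.
left; move: h5; rewrite sE /= /norm1 big_nil => h5.
by split; [ | vec_ring | lia].
Qed.

Definition min_config m u n :=
  config m u n /\ forall n', config m u n' -> (n <= n')%N.

Lemma min_config_sym m u n : min_config m u n -> min_config (- m) (swap u) n.
Proof.
move=> [c c_min]; split; first exact: config_sym.
by move=> n' /config_sym; rewrite opprK swapK; exact: c_min.
Qed.

Lemma config_total (m : nat) u n : config m u n ->
  exists y z, u = y + swap z /\ (total T m.+1 y z <= n + 2)%N.
Proof.
move=> [s [s' [[h1 h2] [h3 h4] -> h5]]].
exists (tape_val T s), (tape_val T s'); split=> //.
have h6 : (halfcost T m.+1 (tape_val T s) <= tape_cost m.+1 s)%N.
  by apply: halfcost_min; exists s; split=> //; lia.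
have h7 : (halfcost T 1 (tape_val T s') <= tape_cost 1 s')%N.
  by apply: halfcost_min; exists s'; split=> //; lia.
by move: h6 h7; rewrite /total /tape_cost; lia.
Qed.

Lemma total_config (m : nat) y z :
  exists2 n, config m (y + swap z) n & (n + 2)%N = total T m.+1 y z.
Proof.
have [s [h1 <- h2]] := halfcost_attained T m.+1 y.
have [s' [h3 <- h4]] := halfcost_attained T 1 z.
exists (tape_cost m.+1 s + tape_cost 1 s' - 2)%N; last first.
  by rewrite /total -h2 -h4 /tape_cost; lia.
by exists s, s'; split=> //; rewrite /tape_cost; lia.
Qed.

(** The constant 2 arises because each half charges one unit for the cell next
    to the cut, whereas these two cells are within reach of the cursor without
    any move. *)
Lemma min_config_total (m : nat) u n : min_config m u n <->
  exists y z, [/\ minimal T m.+1 y z, u = y + swap z & total T m.+1 y z = (n + 2)%N].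
Proof.
split=> [[c c_min]|[y [z [yz_min -> yz]]]].
  have [y [z [uE le_n]]] := config_total c; exists y, z.
  have ge_n y' z' : u = y' + swap z' -> (n + 2 <= total T m.+1 y' z')%N.
    by move=> uE'; have [n' + <-] := total_config m y' z'; rewrite -uE' => /c_min; lia.
  have yz : total T m.+1 y z = (n + 2)%N by apply/eqP; rewrite eqn_leq le_n ge_n.
  split=> // v; rewrite yz; apply: ge_n; rewrite uE; vec_ring.
have [n' c n'E] := total_config m y z.
have nn' : n' = n by lia.
subst n'; split=> // n' /config_total[y' [z' [e le_n']]].
have := yz_min (y' - y).
have -> : y + (y' - y) = y' by vec_ring.
have -> : z - swap (y' - y) = z'; last by lia.
by rewrite -[z']swapK -[swap z'](addKr y') -e -[z in LHS]swapK; vec_ring.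
Qed.

End Config.

(** * The word length *)

Section Group.
Variable k : int.
Notation T := (2 * k + 1).
Notation G := (semiZ (ASL k)).
Implicit Types (g h : G) (x : 'cV[int]_2).

(** The coordinates (x0, x1) mean x0 + x1 X, and X = T - X^-1. *)
Definition coord x : vec := (x 0 0 + T * x 1 0, - x 1 0).

Lemma coordD : {morph coord : x y / x + y}.
Proof. by move=> x y; apply: vec_ext; rewrite /coord /= !mxE; ring. Qed.

Lemma coordA x : coord (Amx k *m x) = mulX T (coord x).
Proof.
apply: vec_ext; rewrite /coord /mulX /= !mxE !big_ord_recl !big_ord0 !mxE /=;
  rewrite (_ : lift ord0 ord0 = 1) //; try exact: val_inj; ring.
Qed.

Definition uncoord (u : vec) : 'cV[int]_2 :=
  \col_i (if i == 0 then u.1 + T * u.2 else - u.2).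

Lemma coordK : cancel coord uncoord.
Proof.
move=> x; apply/matrixP => i j; rewrite !mxE /= ord1.
case: i => [[|[|//]] hi].
  rewrite (_ : Ordinal hi = 0) //=; last exact: val_inj.
  ring.
rewrite (_ : Ordinal hi = 1) //=; last exact: val_inj.
ring.
Qed.

Lemma uncoordK : cancel uncoord coord.
Proof. by move=> u; apply: vec_ext; rewrite /coord /= !mxE /=; ring. Qed.

Let A := val (ASL k).
Let A_unit : A \is a GRing.unit := SL2Z_unit (ASL k).

(** The vector part as seen from the cursor, the cut being between tpart g and
    tpart g + 1. *)
Definition pos g : vec := coord (A ^ (- (tpart g + 1)) *m vecpart g).

Lemma coordAV x : coord (A ^ (-1) *m x) = divX T (coord x).
Proof.
rewrite -[LHS](mulXK T) -coordA mulmxA -[_ *m A ^ _]/(A * A ^ (-1)).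
by rewrite -{1}[A]expr1z -exprzDr // subrr expr0z mul1mx.
Qed.

Lemma pos_a g e : pos (g * SemiZ (ASL k) (e *: delta_mx 0 0)%R 0%R)%g = pos g + lin e.
Proof.
rewrite /pos /= addr0 mulmxDr coordD; congr (_ + _).
rewrite mulmxA -[_ ^ _ *m _]/(A ^ (- (tpart g + 1)) * A ^ tpart g) -exprzDr //.
have -> : - (tpart g + 1) + tpart g = -1 by ring.
by rewrite coordAV; apply: vec_ext; rewrite /coord /divX /= !mxE /=; ring.
Qed.

Lemma pos_b g e : pos (g * SemiZ (ASL k) (e *: delta_mx 1 0)%R 0%R)%g = pos g + cst e.
Proof.
rewrite /pos /= addr0 mulmxDr coordD; congr (_ + _).
rewrite mulmxA -[_ ^ _ *m _]/(A ^ (- (tpart g + 1)) * A ^ tpart g) -exprzDr //.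
have -> : - (tpart g + 1) + tpart g = -1 by ring.
by rewrite coordAV; apply: vec_ext; rewrite /coord /divX /= !mxE /=; ring.
Qed.

Lemma pos_t g : pos (g * gen_t (ASL k))%g = divX T (pos g).
Proof.
rewrite /pos /= mulmx0 addr0 -coordAV mulmxA.
have -> : - (tpart g + 1 + 1) = -1 + - (tpart g + 1) by ring.
by rewrite exprzDr.
Qed.

Lemma pos_tV g : pos (g * (gen_t (ASL k))^-1)%g = mulX T (pos g).
Proof. by rewrite -[g in RHS](mulgVK (gen_t (ASL k))) pos_t divXK. Qed.

Lemma pos1 : pos 1%g = 0.
Proof. by rewrite /pos mulmx0; apply: vec_ext; rewrite /coord /= !mxE; ring. Qed.

Lemma pos_inj g h : pos g = pos h -> tpart g = tpart h -> g = h.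
Proof.
case: g h => [x m] [y m']; rewrite /pos /= => + mm'; rewrite -mm'.
move=> /(can_inj coordK)/(congr1 (mulmx (A ^ (m + 1)))).
rewrite !mulmxA -[_ ^ _ *m _ ^ _]/(A ^ (m + 1) * A ^ (- (m + 1))) -exprzDr //.
by rewrite subrr expr0z !mul1mx => ->.
Qed.

Lemma pos_onto m u : exists g, pos g = u /\ tpart g = m.
Proof.
exists (SemiZ (ASL k) (A ^ (m + 1) *m uncoord u) m); split=> //.
rewrite /pos /= mulmxA -[_ ^ _ *m _ ^ _]/(A ^ (- (m + 1)) * A ^ (m + 1)) -exprzDr //.
by rewrite addNr expr0z mul1mx uncoordK.
Qed.

Definition is_gen g := std_gens (ASL k) g \/ std_gens (ASL k) (g^-1)%g.

Lemma genV (x : 'cV[int]_2) : ((vec_elt (ASL k) x)^-1)%g = vec_elt (ASL k) (- x).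
Proof.
apply: (mulIg (vec_elt (ASL k) x)); rewrite mulVg; congr SemiZ => /=.
by rewrite expr0z mul1mx addNr.
Qed.

Lemma gen_cases g : is_gen g ->
  [\/ exists2 e, `|e|%N = 1%N & g = SemiZ (ASL k) (e *: delta_mx 0 0) 0,
      exists2 e, `|e|%N = 1%N & g = SemiZ (ASL k) (e *: delta_mx 1 0) 0
    | g = gen_t (ASL k) \/ g = ((gen_t (ASL k))^-1)%g].
Proof.
case=> -[[]|] => gE.
- by apply: Or31; exists 1 => //; rewrite gE scale1r.
- by apply: Or32; exists 1 => //; rewrite gE scale1r.
- by apply: Or33; left.
- by apply: Or31; exists (-1) => //; rewrite -[g]invgK gE genV scaleN1r.
- by apply: Or32; exists (-1) => //; rewrite -[g]invgK gE genV scaleN1r.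
- by apply: Or33; right; rewrite -[g]invgK gE.
Qed.

Lemma gen_of_a e : `|e|%N = 1%N -> is_gen (SemiZ (ASL k) (e *: delta_mx 0 0) 0).
Proof.
move=> e1; have [->|->] : e = 1 \/ e = -1 by lia.
  by left; left; left; rewrite scale1r.
by right; left; left; rewrite [(_^-1)%g]genV scaleN1r opprK.
Qed.

Lemma gen_of_b e : `|e|%N = 1%N -> is_gen (SemiZ (ASL k) (e *: delta_mx 1 0) 0).
Proof.
move=> e1; have [->|->] : e = 1 \/ e = -1 by lia.
  by left; left; right; rewrite scale1r.
by right; left; right; rewrite [(_^-1)%g]genV scaleN1r opprK.
Qed.

Lemma gen_step g s : is_gen s ->
  step T (tpart g) (pos g) (tpart (g * s)%g) (pos (g * s)%g).
Proof.
case/gen_cases=> [[e e1 ->]|[e e1 ->]|[->|->]].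
- by rewrite pos_a; apply: Or31; split; [exact: addr0 | exists e => //; left].
- by rewrite pos_b; apply: Or31; split; [exact: addr0 | exists e => //; right].
- by rewrite pos_t; apply: Or32.
- by rewrite pos_tV; apply: Or33.
Qed.

Lemma step_gen g m' u' : step T (tpart g) (pos g) m' u' ->
  exists2 s, is_gen s & tpart (g * s)%g = m' /\ pos (g * s)%g = u'.
Proof.
case=> -[->].
- move=> [e e1 [] ->].
    exists (SemiZ (ASL k) (e *: delta_mx 0 0) 0); first exact: gen_of_a.
    by rewrite pos_a; split=> //; exact: addr0.
  exists (SemiZ (ASL k) (e *: delta_mx 1 0) 0); first exact: gen_of_b.
  by rewrite pos_b; split=> //; exact: addr0.
- by move=> ->; exists (gen_t (ASL k)); [left; right | rewrite pos_t].
- move=> ->; exists ((gen_t (ASL k))^-1)%g; last by rewrite pos_tV.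
  by right; right; exact: invgK.
Qed.

Definition gconfig g n := config T (tpart g) (pos g) n.

Lemma gconfig1 : gconfig 1%g 0.
Proof.
rewrite /gconfig pos1; exists [:: 0], [:: 0].
by rewrite norm1_cons /norm1 big_nil /=; split=> //; vec_ring.
Qed.

Lemma word_gconfig (w : seq G) : is_word (std_gens (ASL k)) w ->
  exists2 n, (n <= size w)%N & gconfig (\prod_(x <- w) x)%g n.
Proof.
elim/last_ind: w => [|w s IHw] Sw.
  by exists 0%N => //; rewrite big_nil; exact: gconfig1.
have [|n le_n c] := IHw.
  by move=> x xw; apply: Sw; rewrite mem_rcons inE xw orbT.
have /gen_step st : is_gen s by apply: Sw; rewrite mem_rcons mem_head.
have [n' le_n' c'] := config_step (st _) c.
exists n'; first by rewrite size_rcons; lia.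
by rewrite big_rcons.
Qed.

Lemma gconfig_word g n : gconfig g n ->
  exists2 w, represents (std_gens (ASL k)) w g & size w = n.
Proof.
elim: n g => [|n IHn] g /config_descent[[m0 u0 n0]|[m' [u' [n' [st c nn']]]]] //.
  exists [::] => //; split=> //; rewrite big_nil; apply/esym/pos_inj => //.
  by rewrite pos1.
have [s Ss [m'E u'E]] := step_gen st.
have {}nn' : n' = n by lia.
have [|w [Sw wE] sz] := IHn (g * s)%g; first by rewrite /gconfig m'E u'E -nn'.
exists (rcons w s^-1)%g; last by rewrite size_rcons sz.
split; last by rewrite big_rcons /= wE mulgK.
move=> x; rewrite mem_rcons inE => /predU1P[->|/Sw//].
by case: Ss => Ss; [right; rewrite invgK | left].
Qed.

Lemma word_lengthP g n : has_word_length (std_gens (ASL k)) g n <->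
  min_config T (tpart g) (pos g) n.
Proof.
split=> [[[w [Sw wg] wn] n_min]|[/gconfig_word[w wg wn] n_min]].
  have n_le n' : config T (tpart g) (pos g) n' -> (n <= n')%N.
    by move=> /gconfig_word[w' w'g <-]; exact: n_min.
  split=> //; have [n' le_n' c] := word_gconfig Sw; rewrite wg in c.
  suff -> : n = n' by [].
  by apply/eqP; rewrite eqn_leq n_le //= -wn.
split; first by exists w.
by move=> w' [Sw' w'g]; have [n' le_n' c] := word_gconfig Sw'; rewrite w'g in c;
  exact: leq_trans (n_min _ c) le_n'.
Qed.

End Group.

(** * Spheres and balls *)

Section Spheres.
Variable k : int.
Notation T := (2 * k + 1).
Notation G := (semiZ (ASL k)).
Notation S := (std_gens (ASL k)).

Definition sphere n : set G := [set g | has_word_length S g n].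

Lemma finite_std_ball n : finite_set (word_ball S n).
Proof. by apply: finite_word_ball; exact: finite_set3. Qed.

Lemma finite_sphere n : finite_set (sphere n).
Proof. by apply: sub_finite_set (finite_std_ball n) => g gn; exists n. Qed.

Lemma word_length_unique g m n :
  has_word_length S g m -> has_word_length S g n -> m = n.
Proof.
move=> [[w wg <-] m_min] [[w' w'g <-] n_min].
by apply/eqP; rewrite eqn_leq m_min ?n_min.
Qed.

Lemma card_ball n : ball_size S n = (\sum_(i < n.+1) card (sphere i))%N.
Proof.
rewrite [LHS](@card_partition _ 'I_n.+1 (word_ball S n) (fun i => sphere i)).
- apply: eq_bigr => i _; congr card; apply/seteqP; split=> [g []//|g gi].
  by split=> //; exists (i : nat) => //; rewrite -ltnS.
- exact: finite_std_ball.
- by move=> g [m gm mn]; exists (Ordinal (mn : (m < n.+1)%N)).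
- by move=> g i i' _ gi gi'; apply: val_inj; exact: word_length_unique gi gi'.
Qed.

(** Elements with negative exponent are reflected, which exchanges the two
    halves; level 2 then avoids counting the exponent 0 twice. *)
Lemma card_sphere n :
  card (sphere n) = (card (gluings T 1 n.+2) + card (gluings T 2 n.+2))%N.
Proof.
pose R (b : bool) : set G := [set g | (0 <= tpart g) = b].
rewrite (@card_partition _ bool (sphere n) R); first last.
- by move=> g b b' _ <- <-.
- by move=> g _; exists (0 <= tpart g).
- exact: finite_sphere.
have finR b : finite_set (sphere n `&` R b).
  by apply: sub_finite_set (finite_sphere n) => g [].
have reachP (m : nat) u :
    min_config T m u n <-> exists y z,
      [/\ minimal T m.+1 y z, u = y + swap z & total T m.+1 y z = n.+2].
  by rewrite min_config_total addn2.
rewrite big_bool; congr addn.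
  pose f (g : G) : nat * vec := (`|tpart g|.+1, pos g).
  rewrite -(@card_image _ _ f _ (finR true)); last first.
    move=> g h /set_mem[_ g0] /set_mem[_ h0] fgh.
    have e1 : `|tpart g|.+1 = `|tpart h|.+1 := congr1 fst fgh.
    apply: pos_inj; first exact: (congr1 snd fgh).
    by move: g0 h0; rewrite /R /=; lia.
  congr card; apply/seteqP; split=> [_ [g [/word_lengthP gn g0] <-]|[j u] [/= j1 yz]].
    split=> //=; apply/reachP; rewrite (_ : (`|tpart g|%N : int) = tpart g) //.
    by move: g0; rewrite /R /=; lia.
  have [g [gu gj]] := pos_onto k (j.-1 : nat) u; exists g; last first.
    by rewrite /f gu gj /= prednK.
  split; last by rewrite /R /= gj.
  by apply/word_lengthP; rewrite gu gj; apply/reachP; rewrite prednK.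
pose f (g : G) : nat * vec := (`|tpart g|.+1, swap (pos g)).
rewrite -(@card_image _ _ f _ (finR false)); last first.
  move=> g h /set_mem[_ g0] /set_mem[_ h0] fgh.
  have e1 : `|tpart g|.+1 = `|tpart h|.+1 := congr1 fst fgh.
  have e2 : swap (pos g) = swap (pos h) := congr1 snd fgh.
  apply: pos_inj; first exact: (can_inj swapK).
  by move: g0 h0; rewrite /R /=; lia.
congr card; apply/seteqP; split=> [_ [g [/word_lengthP gn g0] <-]|[j u] [/= j1 yz]].
  rewrite /R /= in g0; split=> /=; first by lia.
  apply/reachP; rewrite (_ : (`|tpart g|%N : int) = - tpart g); last by lia.
  exact: min_config_sym.
have [g [gu gj]] := pos_onto k (- (j.-1 : nat)%:Z) (swap u); exists g; last first.
  by rewrite /f gu gj swapK; congr (_, _); lia.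
split; last by rewrite /R /= gj; lia.
apply/word_lengthP; rewrite gu gj; apply: min_config_sym.
by apply/reachP; rewrite prednK //; lia.
Qed.

End Spheres.

Theorem theorem1 (k : int) (hk : (5 <= 2 * k + 1)%R) :
  rational_growth (std_gens (ASL k)).
Proof.
have rat1 := rational_gluings hk (isT : (1 <= 1 <= 2)%N).
have rat2 := rational_gluings hk (isT : (1 <= 2 <= 2)%N).
apply: eq_rational (rationalM (rationalD (rational_tail (rational_tail rat1))
  (rational_tail (rational_tail rat2))) (rational1 _)) => n.
rewrite card_ball natr_sum; apply: eq_bigr => i _.
by rewrite mulr1 card_sphere natrD.
Qed.
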